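(* Let $\mathfrak{o}$ be a complete discrete valuation ring with finite residue field of odd characteristic, with fraction field $K$, let $\mathbf{G}$ be a symplectic or a special orthogonal group scheme over $\mathfrak{o}$ with $\mathbf{g}=\mathrm{Lie}(\mathbf{G})$, and let $x\in\mathbf{g}(\mathfrak{o})$. For $m\ge1$ let $x_m$ be the image of $x$ in $\mathbf{g}(\mathfrak{o}_m)$. Assume that $x_r$ is regular for some $r\ge 1$. Then: (1) $\mathbf{C}_G(x)=\varprojlim_{m}\mathbf{C}_{G_m}(x_m)$, where $G=\mathbf{G}(\mathfrak{o})$, $G_m=\mathbf{G}(\mathfrak{o}_m)$ and the inverse limit is taken with respect to the reduction maps. (2) Furthermore, $x$ is a regular element of $\mathbf{g}(K^{\mathrm{alg}})$, i.e. its centralizer in $\mathbf{G}(K^{\mathrm{alg}})$ has minimal dimension among centralizers of elements of $\mathbf{g}(K^{\mathrm{alg}})$.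
   Context: $\mathsf{k}$ is the residue field of $\mathfrak{o}$, $\mathfrak{p}=\pi\mathfrak{o}$ its maximal ideal, $\mathfrak{o}_m=\mathfrak{o}/\mathfrak{p}^m$; $K^{\mathrm{alg}}$ is an algebraic closure of $K$; $\mathfrak{O}$ is the valuation ring of the maximal unramified extension of $K$, with residue field $\mathsf{k}^{\mathrm{alg}}$, and $\mathfrak{O}_m=\mathfrak{O}/\pi^m\mathfrak{O}$. Group scheme: fix $\mathbf{J}\in\mathrm{GL}_N(\mathfrak{o})$ with $\mathbf{J}^t=-\mathbf{J}$ (symplectic case) or $\mathbf{J}^t=\mathbf{J}$ (special orthogonal case). For a commutative $\mathfrak{o}$-algebra $R$, $\mathbf{G}(R)=\{x\in \mathrm{M}_N(R): x^t\mathbf{J}x=\mathbf{J},\ \det x=1\}$ and $\mathbf{g}(R)=\{x\in\mathrm{M}_N(R): x^t\mathbf{J}+\mathbf{J}x=0\}$; $\mathbf{G}(R)$ acts on $\mathbf{g}(R)$ by conjugation. Regularity over $\mathfrak{O}_m$: by the Greenberg functor, $\mathbf{G}(\mathfrak{O}_m)$ is the group of $\mathsf{k}^{\mathrm{alg}}$-points of a linear algebraic group $\boldsymbol{\Gamma}_m$ over $\mathsf{k}^{\mathrm{alg}}$ (viewing $\mathfrak{O}_m$ as the $\mathsf{k}^{\mathrm{alg}}$-points of an $m$-dimensional affine-space ring scheme), and for $y\in\mathbf{g}(\mathfrak{O}_m)$ the centralizer $\mathbf{C}_{\mathbf{G}(\mathfrak{O}_m)}(y)$ is the set of $\mathsf{k}^{\mathrm{alg}}$-points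 of a closed subgroup scheme $\mathbf{C}_{\boldsymbol{\Gamma}_m}(y)$. The element $y$ is regular if $\dim\mathbf{C}_{\boldsymbol{\Gamma}_m}(y)$ is minimal among all elements of $\mathbf{g}(\mathfrak{O}_m)$. An element of $\mathbf{g}(\mathfrak{o}_m)$ is regular if it is regular as an element of $\mathbf{g}(\mathfrak{O}_m)$. *)

(* Defs.v *)
From HB Require Import structures.
From mathcomp Require Import all_boot all_order all_algebra all_field.
From mathcomp Require Import boolp classical_sets functions.
From mathcomp Require Import mpoly.

Set Implicit Arguments.
Unset Strict Implicit.
Unset Printing Implicit Defensive.

Import GRing.Theory.
Local Open Scope ring_scope.
Local Open Scope quotient_scope.
Local Open Scope classical_set_scope.

Section PowerQuotient.
Variables (A : comNzRingType) (a : A) (m : nat).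

Definition pow_ideal : {pred A} := [pred x | `[< exists b, x = a ^+ m * b >]].

Fact pow_ideal_zmod_closed : zmod_closed pow_ideal.
Proof.
split=> [|x y /asboolP [b ->] /asboolP [c ->]]; apply/asboolP.
  by exists 0; rewrite mulr0.
by exists (b - c); rewrite mulrBr.
Qed.
HB.instance Definition _ := GRing.isZmodClosed.Build A pow_ideal
  pow_ideal_zmod_closed.

Fact pow_idealM x y : y \in pow_ideal -> x * y \in pow_ideal.
Proof. by case/asboolP=> b ->; apply/asboolP; exists (x * b); rewrite mulrCA. Qed.

(* [Quotient.quot] only becomes a ring for proper ideals in the library;        *)
(* here the zero ring is allowed, so that no hypothesis on a and m is needed.   *)
Definition pow_quot : Type := @Quotient.quot A pow_ideal.
HB.instance Definition _ := GRing.Zmodule.on pow_quot.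

Definition pow_red (x : A) : pow_quot := \pi_(@Quotient.quot A pow_ideal) x.
Definition pow_rep (u : pow_quot) : A := repr (u : @Quotient.quot A pow_ideal).

Lemma pow_repK u : pow_red (pow_rep u) = u.
Proof. exact: reprK. Qed.

Lemma pow_redP x y : pow_red x = pow_red y <-> x - y \in pow_ideal.
Proof. by rewrite Quotient.idealrBE; split=> /eqP. Qed.

Fact pow_red_zmod_morphism : zmod_morphism pow_red.
Proof. exact: pi_is_zmod_morphism. Qed.
HB.instance Definition _ := GRing.isZmodMorphism.Build A pow_quot pow_red
  pow_red_zmod_morphism.

Definition pow_quot_mul (u v : pow_quot) := pow_red (pow_rep u * pow_rep v).

Fact pow_red_mul x y : pow_red (x * y) = pow_quot_mul (pow_red x) (pow_red y).
Proof.
apply/pow_redP; set x' := pow_rep _; set y' := pow_rep _.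
have hx : x - x' \in pow_ideal by apply/pow_redP; rewrite pow_repK.
have hy : y - y' \in pow_ideal by apply/pow_redP; rewrite pow_repK.
have -> : x * y - x' * y' = y * (x - x') + x' * (y - y').
  by rewrite !mulrBr [y * x]mulrC [y * x']mulrC addrA subrK.
by rewrite rpredD ?pow_idealM.
Qed.

Fact pow_quot_mulA : associative pow_quot_mul.
Proof.
move=> u v w; rewrite -[u]pow_repK -[v]pow_repK -[w]pow_repK.
by rewrite -!pow_red_mul mulrA.
Qed.
Fact pow_quot_mulC : commutative pow_quot_mul.
Proof. by move=> u v; rewrite /pow_quot_mul mulrC. Qed.
Fact pow_quot_mul1 : left_id (pow_red 1) pow_quot_mul.
Proof. by move=> u; rewrite -[u]pow_repK -pow_red_mul mul1r. Qed.
Fact pow_quot_mulDl : left_distributive pow_quot_mul +%R.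
Proof.
move=> u v w; rewrite -[u]pow_repK -[v]pow_repK -[w]pow_repK.
by rewrite -raddfD -!pow_red_mul mulrDl raddfD.
Qed.
HB.instance Definition _ := GRing.Zmodule_isComPzRing.Build pow_quot
  pow_quot_mulA pow_quot_mulC pow_quot_mul1 pow_quot_mulDl.

Fact pow_red_monoid_morphism : monoid_morphism pow_red.
Proof. by split=> // x y; rewrite pow_red_mul. Qed.
HB.instance Definition _ := GRing.isMonoidMorphism.Build A pow_quot pow_red
  pow_red_monoid_morphism.

End PowerQuotient.

(* The map A/a^m -> B/b^n induced by f : A -> B; meaningful when f is a ring    *)
(* morphism sending a^m into the ideal generated by b^n.                        *)
Definition pow_quot_map (A B : comNzRingType) (f : A -> B) (a : A) (b : B)
    (m n : nat) (u : pow_quot a m) : pow_quot b n :=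
  pow_red b n (f (pow_rep u)).

Definition complete_dvr (o : idomainType) (pi : o) : Prop :=
  [/\ pi != 0, pi \isn't a GRing.unit,
      forall a, a != 0 ->
        exists n, exists2 u, u \is a GRing.unit & a = u * pi ^+ n
    & forall s : nat -> o,
        (forall n, s n.+1 - s n \in pow_ideal pi n) ->
        exists l, forall n, l - s n \in pow_ideal pi n].

Definition is_residue_map (A : idomainType) (pi : A) (F : fieldType)
    (res : {rmorphism A -> F}) : Prop :=
  (forall c, exists a, res a = c) /\
  (forall a, res a = 0 <-> a \in pow_ideal pi 1).

Definition is_algebraic_closure (K : fieldType) (L : closedFieldType)
    (iota : {rmorphism K -> L}) : Prop :=
  forall z, algebraicOver iota z.

(* For o complete, the valuation ring of the finite extension L is the integral *)
(* closure of o. The condition says that a uniformizer of o remains one in L;   *)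
(* separability of the residue extension is not imposed, which is harmless as   *)
(* the residue field of o will be finite.                                       *)
Definition unramified (o : idomainType) (pi : o)
    (L : fieldExtType {fraction o}) : Prop :=
  let oL (a : o) : L := (tofrac a)%:A in
  forall y, integralOver oL y ->
    (exists2 y', integralOver oL y' & y * y' = 1) \/
    (exists2 z, integralOver oL z & y = oL pi * z).

(* O is, through j, the valuation ring of the union of the finite unramified    *)
(* subextensions of Kalg.                                                       *)
Definition is_max_unramified_ring (o : idomainType) (pi : o)
    (Kalg : closedFieldType) (iota : {rmorphism {fraction o} -> Kalg})
    (O : idomainType) (i : {rmorphism o -> O}) (j : {rmorphism O -> Kalg}) :
    Prop :=
  [/\ injective j,
      forall a, j (i a) = iota (tofrac a)
    & forall z : Kalg,
        (exists w, j w = z) <->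
        integralOver (iota \o @tofrac o) z /\
        exists (L : fieldExtType {fraction o}) (f : {rmorphism L -> Kalg}),
          [/\ forall c, f c%:A = iota c, unramified pi L
            & exists y, f y = z]].

Section Zariski.
Variables (F : fieldType) (n : nat).

Definition zeros (S : set {mpoly F[n]}) : set 'rV[F]_n :=
  [set v | forall p, S p -> p.@[v 0] = 0].

Definition zariski_closed (V : set 'rV[F]_n) : Prop := exists S, V = zeros S.

Definition irreducible_set (Z : set 'rV[F]_n) : Prop :=
  Z !=set0 /\
  forall A B, zariski_closed A -> zariski_closed B ->
    Z `<=` A `|` B -> Z `<=` A \/ Z `<=` B.

(* Krull dimension at least d, for a Zariski closed V. *)
Definition dim_ge (V : set 'rV[F]_n) (d : nat) : Prop :=
  exists Z : nat -> set 'rV[F]_n,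
    (forall e, (e <= d)%N ->
       [/\ zariski_closed (Z e), irreducible_set (Z e) & Z e `<=` V]) /\
    (forall e, (e < d)%N -> Z e `<` Z e.+1).

Definition dim_le (V W : set 'rV[F]_n) : Prop :=
  forall d, dim_ge V d -> dim_ge W d.

End Zariski.

(* A structure of ring scheme on the affine m-space over the residue field F of *)
(* O, with ring of F-points O/pi^m, for which reduction to F is a morphism.     *)
(* Over an infinite field such as F, this amounts to the given polynomial laws  *)
(* on points (the opposite is the product with -1). Greenberg's realization, by *)
(* (Witt) coordinates with respect to a uniformizer, is an instance.            *)
Record greenberg_structure (O : idomainType) (pi : O) (F : closedFieldType)
    (res : {rmorphism O -> F}) (m : nat) := GreenbergStructure {
  gr_coord :> pow_quot pi m -> 'rV[F]_m;
  gr_bij : bijective gr_coord;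
  gr_add : exists P : 'I_m -> {mpoly F[m + m]}, forall u v l,
    gr_coord (u + v) 0 l = (P l).@[row_mx (gr_coord u) (gr_coord v) 0];
  gr_mul : exists P : 'I_m -> {mpoly F[m + m]}, forall u v l,
    gr_coord (u * v) 0 l = (P l).@[row_mx (gr_coord u) (gr_coord v) 0];
  gr_res : exists P : {mpoly F[m]}, forall a,
    res a = P.@[gr_coord (pow_red pi m a) 0]
}.

Definition mx_coord (R : Type) (F : Type) (m N : nat) (c : R -> 'rV[F]_m)
    (X : 'M[R]_N) : 'rV[F]_(N * N * m) :=
  mxvec (\matrix_(e < N * N) c (mxvec X 0 e)).

Section ClassicalGroup.
Variables (o R : comPzRingType) (f : o -> R) (N : nat) (J : 'M[o]_N).
Let JR := map_mx f J.

Definition cl_group : set 'M[R]_N :=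
  [set g | g^T *m JR *m g = JR /\ \det g = 1].

Definition cl_lie : set 'M[R]_N := [set y | y^T *m JR + JR *m y = 0].

Definition cl_centralizer (y : 'M[R]_N) : set 'M[R]_N :=
  [set g | cl_group g /\ g *m y = y *m g].

(* phi identifies N x N matrices over R with the points of an affine space, in  *)
(* such a way that centralizers become Zariski closed.                          *)
Definition cl_regular (F : fieldType) (n : nat) (phi : 'M[R]_N -> 'rV[F]_n)
    (y : 'M[R]_N) : Prop :=
  cl_lie y /\
  forall z, cl_lie z ->
    dim_le (phi @` cl_centralizer y) (phi @` cl_centralizer z).

End ClassicalGroup.

(* Regularity of an element of g(o/pi^m), tested in g(O/pi^m). *)
Definition cl_regular_mod (o O : idomainType) (pi : o)
    (i : {rmorphism o -> O}) (F : closedFieldType) (res : {rmorphism O -> F})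
    (m : nat) (gr : greenberg_structure (i pi) res m) (N : nat) (J : 'M[o]_N)
    (y : 'M[pow_quot pi m]_N) : Prop :=
  cl_regular (pow_red (i pi) m \o i) J (mx_coord gr)
    (map_mx (@pow_quot_map o O i pi (i pi) m m) y).

(* The levels m >= 1 are indexed by their predecessors. *)
Definition centralizer_limit (o : idomainType) (pi : o) (N : nat)
    (J x : 'M[o]_N) : set (forall m, 'M[pow_quot pi m.+1]_N) :=
  [set h | forall m,
     cl_centralizer (pow_red pi m.+1) J (map_mx (pow_red pi m.+1) x) (h m) /\
     map_mx (@pow_quot_map o o idfun pi pi m.+2 m.+1) (h m.+1) = h m].
Arguments centralizer_limit {o} pi {N} J x _.

(* Main.v *)
(* For X in the Lie algebra, the Cayley transform g = (1 - X)(1 + X)^-1 maps an *)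
(* open part of the linear centralizer of y onto the open part of the           *)
(* centralizer of y in the group where 1 + g is invertible. So the dimension of *)
(* the latter is that of the former: over a field, the corank of                *)
(* L(y) : X |-> (X^T J + J X, X y - y X); over O_r, the length of ker L(y).     *)
(* With n = floor(N / 2), a cyclic y in the Lie algebra has centralizer spanned *)
(* by its n odd powers y, y^3, ..., and every corank is at least n, as seen by  *)
(* deforming to a cyclic element over F(t). If the corank of L(x) modulo pi     *)
(* exceeded n, then ker L(x_r) would contain a free module of rank n and one    *)
(* more copy of k^alg, so C(x_r) would have dimension at least r n + 1, while   *)
(* the lift to O_r of a cyclic element has centralizer of dimension r n. Hence  *)
(* the corank modulo pi, and a fortiori over K^alg, is at most n.               *)
(* The limit in (1) exists by completeness alone.                               *)
From HB Require Import structures.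
Require Import Defs.
From mathcomp Require Import all_boot all_order all_algebra all_field.
From mathcomp Require Import boolp classical_sets functions.
From mathcomp Require Import mpoly zify ring.

Set Implicit Arguments.
Unset Strict Implicit.
Unset Printing Implicit Defensive.

Import GRing.Theory.
Local Open Scope ring_scope.
Local Open Scope classical_set_scope.

(** * Cyclic elements of the Lie algebra *)

(** Dimensions of centralizers are reduced to linear algebra. Put [n = N./2] and, for [y] in the Lie
    algebra, let L(y) be [lie_centralizer_mx], whose kernel is the centralizer of [y] in the Lie
    algebra. As 2 is invertible, the Cayley transform exchanges the part of this kernel where 1 + X
    is invertible with the part of the group centralizer where 1 + g is invertible
    ([cayley_centralizer], [centralizer_cayley]).

    Krull dimensions are then compared by elementary means, once for all rings of type
    [ring_variety], which cover both O/pi^r and [Kalg]. Upper bound ([centralizer_dim_le]): a chain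
    of length d yields s^d independent monomials with exponents O(s) ([dim_ge_independent]); pulled
    back to D parameters, they are independent polynomials of degree O(s), of which there are at
    most O(s^D), so d <= D. Lower bound ([centralizer_dim_ge]): an increasing family of submodules
    of the kernel has Cayley images whose closures form a strict chain of irreducible sets.

    On the linear side, a nondegenerate symmetric or alternating form has a cyclic element in its
    Lie algebra ([cyclic_lie_exists]), whose Lie centralizer is spanned by n odd powers
    ([cyclic_lie_centralizer]); by deformation every corank is at least n ([rank_lie_centralizer]).
    Regularity of the reduction of [x] bounds the corank of L(x) over the residue field by n
    ([rank_residue]): a larger corank would give the centralizer over O/pi^r dimension at least r n
    + 1, against r n for the lift of a cyclic element. Ranks can only grow from the residue field to
    [Kalg] ([mxrank_map_le]), so the centralizer of [x] over [Kalg] has dimension at most n, the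
    least possible ([regular_over_Kalg]).

    The inverse limit is independent of regularity: uniqueness is separatedness of the pi-adic
    topology and existence is its completeness, entry by entry ([centralizer_limit_bij]). *)

Section Cyclic.
Variables (R : comPzRingType) (N : nat).
Implicit Types (v : 'rV[R]_N) (y X : 'M[R]_N).

(** [v] is a cyclic vector of [y] exactly when this matrix is invertible. *)
Definition krylov v y : 'M[R]_N := \matrix_(i < N) (v *m y ^+ i).

Definition odd_powers y : 'M[R]_(N./2, N * N) :=
  \matrix_(i < N./2) mxvec (y ^+ i.*2.+1).

Definition lie_centralizer (J y X : 'M[R]_N) : Prop :=
  X^T *m J + J *m X = 0 /\ X *m y = y *m X.

Lemma lie_expr J y k : y^T *m J + J *m y = 0 ->
  (y ^+ k)^T *m J = (-1) ^+ k *: (J *m y ^+ k).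
Proof.
move=> hy; elim: k => [|k IH]; first by rewrite !expr0 trmx1 mul1mx mulmx1 scale1r.
rewrite exprSr trmx_mul -mulmxA IH -scalemxAr mulmxA.
move/eqP: hy; rewrite addr_eq0 => /eqP ->.
by rewrite mulNmx scalerN exprS mulN1r scaleNr -mulmxA -[y *m _]/(y * _) -exprS exprSr.
Qed.

Lemma sum_odd (V : nmodType) n (F : nat -> V) :
  \sum_(0 <= i < n | odd i) F i = \sum_(i < n./2) F i.*2.+1.
Proof.
elim/ltn_ind: n => -[|[|n]] IH; first by rewrite big_geq // big_ord0.
  by rewrite big_nat_cond big1 ?big_ord0 // => -[|i] //= /andP[].
rewrite big_mkcond big_nat_recr // big_nat_recr // -big_mkcond /= IH //.
rewrite big_ord_recr /=.
by case ho: (odd n); rewrite /= ?addr0 ; congr (_ + F _);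
  have := odd_double_half n; rewrite ho; lia.
Qed.

Lemma odd_powers_lie J y t : y^T *m J + J *m y = 0 ->
  lie_centralizer J y (vec_mx (t *m odd_powers y)).
Proof.
move=> hy; rewrite mulmx_sum_row linear_sum /=.
split.
  rewrite linear_sum /= mulmx_suml mulmx_sumr -big_split big1 //= => i _.
  rewrite linearZ /= rowK mxvecK linearZ /= -scalemxAl -scalemxAr lie_expr //.
  by rewrite -signr_odd /= odd_double expr1 scaleN1r scalerN addNr.
rewrite mulmx_suml mulmx_sumr; apply: eq_bigr => i _.
rewrite linearZ /= rowK mxvecK -scalemxAl -scalemxAr.
by rewrite -[_ *m y]/(_ * y) -[y *m _]/(y * _) -exprSr -exprS.
Qed.

(** A matrix commuting with [y] is determined by the image of the cyclic vector, hence is a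
    polynomial in [y]. The adjoint involution of [J] sends [y] to [- y] and [X] to [- X], so
    comparing [X] with its image kills the even powers once 2 is invertible. *)
Lemma cyclic_lie_centralizer J Ji v y Ki (half : R) :
  Ji *m J = 1%:M -> half *+ 2 = 1 -> krylov v y *m Ki = 1%:M ->
  y^T *m J + J *m y = 0 ->
  forall X, lie_centralizer J y X -> exists t, mxvec X = t *m odd_powers y.
Proof.
move=> hJ h2 hK hy X [hX hXy].
have hK' : Ki *m krylov v y = 1%:M by apply: mulmx1C.
set t := v *m X *m Ki.
have ht : v *m X = \sum_(i < N) t 0 i *: (v *m y ^+ i).
  rewrite -[LHS]mulmx1 -hK' mulmxA -/t mulmx_sum_row.
  by apply: eq_bigr => i _; rewrite rowK.
have hXk k : y ^+ k *m X = X *m y ^+ k.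
  elim: k => [|k IH]; first by rewrite mul1mx mulmx1.
  rewrite exprSr -[_ * y]/(_ *m y) -mulmxA -hXy !mulmxA IH -!mulmxA.
  by congr (_ *m _); rewrite -[y *m _]/(y * _) -[_ *m y]/(_ * y) -exprSr -exprS.
have hp : X = \sum_(i < N) t 0 i *: y ^+ i.
  rewrite -[X]mul1mx -[RHS]mul1mx -hK' -!mulmxA; congr (_ *m _).
  apply/row_matrixP => i; rewrite !row_mul rowK -mulmxA hXk mulmxA ht.
  rewrite mulmx_suml mulmx_sumr; apply: eq_bigr => l _.
  rewrite -scalemxAl -scalemxAr -!mulmxA; congr (_ *: (_ *m _)).
  by rewrite -[LHS]/(_ * _) -[RHS]/(_ * _) -!exprD addnC.
have h2X : X *+ 2 = \sum_(i < N) (t 0 i * (1 - (-1) ^+ i)) *: y ^+ i.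
  have /eqP := hX; rewrite addrC addr_eq0 => /eqP hX'.
  have: X = - \sum_(i < N) (t 0 i * (-1) ^+ i) *: y ^+ i.
    rewrite -[X]mul1mx -hJ -mulmxA hX' mulmxN; congr (- _).
    rewrite {1}hp linear_sum /= mulmx_suml mulmx_sumr; apply: eq_bigr => i _.
    rewrite linearZ /= -scalemxAl lie_expr // scalerA -scalemxAr mulmxA hJ mul1mx //.
  move=> hX''; rewrite mulr2n [X in X + _]hp [X in _ + X]hX'' -sumrB; apply: eq_bigr => i _.
  by rewrite -scalerBl mulrBr mulr1.
pose s k := if insub k is Some i then t 0 i else 0.
have hs (i : 'I_N) : t 0 i = s i by rewrite /s valK.
have {}h2X : X *+ 2 = (\sum_(i < N./2) s i.*2.+1 *: y ^+ i.*2.+1) *+ 2.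
  rewrite h2X -(sum_odd N (fun k => s k *: y ^+ k)) -sumrMnl [RHS]big_mkcond /= big_mkord.
  apply: eq_bigr => i _; rewrite hs -signr_odd.
  by case: odd; rewrite /= ?subrr ?mulr0 ?scale0r // expr1 opprK -mulr2n mulr_natr scalerMnl.
exists (\row_(i < N./2) s i.*2.+1).
have -> : X = \sum_(i < N./2) s i.*2.+1 *: y ^+ i.*2.+1.
  rewrite -[X]scale1r -[RHS]scale1r -h2 -!scalerMnl !scalerMnr.
  by rewrite h2X.
rewrite linear_sum mulmx_sum_row; apply: eq_bigr => i _.
by rewrite linearZ /= rowK mxE.
Qed.
End Cyclic.

(** * The Lie centralizer as a kernel, and its rank under specialization *)

Section LieCentralizerMatrix.
Variables (R : comPzRingType) (N : nat) (J y : 'M[R]_N).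

Definition lie_centralizer_fun (v : 'rV[R]_(N * N)) : 'rV[R]_(N * N + N * N) :=
  let X := vec_mx v in
  row_mx (mxvec (X^T *m J + J *m X)) (mxvec (X *m y - y *m X)).

Fact lie_centralizer_fun_linear : linear lie_centralizer_fun.
Proof.
move=> a u v; rewrite /lie_centralizer_fun scale_row_mx add_row_mx.
have -> : vec_mx (a *: u + v) = a *: vec_mx u + vec_mx v by rewrite linearP.
set X := vec_mx u; set Y := vec_mx v.
have hm (A B : 'M[R]_N) : a *: mxvec A + mxvec B = mxvec (a *: A + B).
  by rewrite linearP.
rewrite !hm [(_ + Y)^T]linearP /=; congr (row_mx (mxvec _) (mxvec _)).
  by rewrite mulmxDl mulmxDr -scalemxAl -scalemxAr scalerDr addrACA.
by rewrite mulmxDl mulmxDr -scalemxAl -scalemxAr scalerBr opprD addrACA.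
Qed.
HB.instance Definition _ := GRing.isLinear.Build R _ _ _ lie_centralizer_fun
  lie_centralizer_fun_linear.

Definition lie_centralizer_mx := lin1_mx lie_centralizer_fun.

Lemma lie_centralizer_mxP v :
  v *m lie_centralizer_mx = 0 <-> lie_centralizer J y (vec_mx v).
Proof.
rewrite mul_rV_lin1 /= /lie_centralizer_fun -row_mx0; split.
  move/eq_row_mx => [/eqP h1 /eqP h2].
  split; first by apply/eqP; rewrite -mxvec_eq0.
  by apply/eqP; rewrite -subr_eq0 -mxvec_eq0.
by case=> h1 h2; rewrite h1 h2 subrr !linear0.
Qed.
End LieCentralizerMatrix.

Lemma map_lie_centralizer_mx (A B : comPzRingType) (f : {rmorphism A -> B}) N
    (J y : 'M[A]_N) :
  map_mx f (lie_centralizer_mx J y) =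
  lie_centralizer_mx (map_mx f J) (map_mx f y).
Proof.
apply: map_lin1_mx => v; rewrite /lie_centralizer_fun map_row_mx.
by rewrite !map_mxvec map_mxD map_mxB !map_mxM -map_trmx map_vec_mx.
Qed.

Lemma map_krylov (A B : comPzRingType) (f : {rmorphism A -> B}) N
    (v : 'rV[A]_N) (y : 'M[A]_N) :
  map_mx f (krylov v y) = krylov (map_mx f v) (map_mx f y).
Proof.
apply/row_matrixP => i; rewrite -map_row !rowK map_mxM; congr (_ *m _).
elim: (val i) => [|k IH]; first by rewrite !expr0 map_mx1.
by rewrite !exprSr -IH -[_ * y]/(_ *m y) map_mxM.
Qed.

(** Rank is semicontinuous: a maximal minor that is nonzero under [f] is also nonzero under [g]. *)
Lemma mxrank_map_le (A : comNzRingType) (E F : fieldType) (f : {rmorphism A -> E})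
    (g : {rmorphism A -> F}) m n (L : 'M[A]_(m, n)) :
  (forall a, g a = 0 -> f a = 0) ->
  (\rank (map_mx f L) <= \rank (map_mx g L))%N.
Proof.
move=> hfg; set k := \rank _; set Lf := map_mx f L in k *.
have hfree : row_free (rowsub (maxrankfun Lf) Lf) by exact: maxrowsub_free.
set p := maxrankfun Lf in hfree.
have hfull : row_full (rowsub p Lf)^T by rewrite /row_full mxrank_tr.
have hd : \det (rowsub (fullrankfun hfull) (rowsub p Lf)^T) != 0.
  by rewrite -unitfE -unitmxE fullrowsub_unit.
set q := fullrankfun hfull in hd.
have key (K : fieldType) (h : {rmorphism A -> K}) :
    rowsub q (rowsub p (map_mx h L))^T = map_mx h (rowsub q (rowsub p L)^T).
  by apply/matrixP => a b; rewrite !mxE.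
have hg : \det (rowsub q (rowsub p (map_mx g L))^T) != 0.
  rewrite key det_map_mx; apply: contraNneq hd => /hfg.
  by rewrite -det_map_mx -key => ->.
have : row_free (rowsub q (rowsub p (map_mx g L))^T).
  by rewrite row_free_unit unitmxE unitfE.
rewrite /row_free => /eqP hr; rewrite /k -{}hr.
apply: leq_trans (mxrankS (rowsub_sub _ _)) _; rewrite mxrank_tr.
exact: mxrankS (rowsub_sub _ _).
Qed.

Section CyclicRank.
Variables (F : fieldType) (N : nat) (J : 'M[F]_N).

Lemma row_free_odd_powers (v : 'rV[F]_N) (y : 'M[F]_N) :
  krylov v y \in unitmx -> row_free (odd_powers y).
Proof.
move=> hK; apply/inj_row_free => t ht.
have h1 : \sum_(i < N./2) t 0 i *: (v *m y ^+ i.*2.+1) = 0.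
  have := congr1 (fun w => v *m vec_mx w) ht.
  rewrite /= linear0 mulmx0 => /esym h0; apply/esym/(etrans h0).
  rewrite [t *m _]mulmx_sum_row linear_sum /= mulmx_sumr; apply: eq_bigr => i _.
  by rewrite linearZ /= rowK mxvecK -scalemxAr.
have hlt (i : 'I_(N./2)) : (i.*2.+1 < N)%N.
  have := ltn_ord i; have := odd_double_half N; lia.
pose s : 'rV[F]_N := \row_(l < N) \sum_(i < N./2 | i.*2.+1 == l) t 0 i.
have hs : s = 0.
  apply: (can_inj (mulmxK hK)); rewrite mul0mx -h1 mulmx_sum_row.
  under eq_bigr do rewrite mxE scaler_suml.
  rewrite (exchange_big_dep xpredT) //=; apply: eq_bigr => i _.
  by rewrite (big_pred1 (Ordinal (hlt i))) ?rowK // => l; rewrite -val_eqE eq_sym.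
apply/rowP => i; rewrite mxE.
have := congr1 (fun u : 'rV_N => u 0 (Ordinal (hlt i))) hs; rewrite !mxE => <-.
rewrite (big_pred1 i) // => l /=; rewrite eqSS -[RHS]val_eqE /=.
by rewrite -!muln2 eqn_mul2r.
Qed.

Lemma cyclic_rank_lie_centralizer (v : 'rV[F]_N) (y : 'M[F]_N) :
  krylov v y \in unitmx -> y^T *m J + J *m y = 0 ->
  (\rank (lie_centralizer_mx J y) <= N * N - N./2)%N.
Proof.
move=> hK hy; have hf := row_free_odd_powers hK.
have h0 : odd_powers y *m lie_centralizer_mx J y = 0.
  apply/row_matrixP => i; rewrite row_mul row0; apply/lie_centralizer_mxP.
  by rewrite rowE; apply: odd_powers_lie.
have := mxrank_mul_ker (odd_powers y) (lie_centralizer_mx J y).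
have hle : (odd_powers y <= kermx (lie_centralizer_mx J y))%MS by apply/sub_kermxP.
have := mxrankS hle; rewrite mxrank_ker (eqP hf).
have := rank_leq_row (lie_centralizer_mx J y); lia.
Qed.
End CyclicRank.

(** On the line [Z] from [z] to the cyclic element [c], the Krylov determinant is nonzero at
    parameter 1, so [Z] is cyclic over the rational function field. The bound holds there, and
    specializing to parameter 0 cannot raise the rank. *)
Lemma rank_lie_centralizer (F : fieldType) N (J c z : 'M[F]_N) (v : 'rV[F]_N) :
  krylov v c \in unitmx -> c^T *m J + J *m c = 0 -> z^T *m J + J *m z = 0 ->
  (\rank (lie_centralizer_mx J z) <= N * N - N./2)%N.
Proof.
move=> hK hc hz.
pose Z := map_mx polyC z + 'X *: map_mx polyC (c - z).
pose JX := map_mx polyC J.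
have ev (a : F) m n (A : 'M[F]_(m, n)) : map_mx (horner_eval a) (map_mx polyC A) = A.
  by apply/matrixP => i j; rewrite !mxE /horner_eval hornerC.
have evZ a : map_mx (horner_eval a) Z = z + a *: (c - z).
  by rewrite map_mxD map_mxZ !ev /= /horner_eval hornerX.
have hcz : (c - z)^T *m J + J *m (c - z) = 0.
  by rewrite linearB /= mulmxBl mulmxBr addrACA -opprD hc hz subrr.
have hP (A : 'M_N) : A^T *m J + J *m A = 0 ->
    (map_mx polyC A)^T *m JX + JX *m map_mx polyC A = 0.
  by move=> hA; rewrite map_trmx -!map_mxM -map_mxD hA map_mx0.
have hZ : Z^T *m JX + JX *m Z = 0.
  rewrite linearD linearZ /= mulmxDl mulmxDr addrACA hP // add0r.
  by rewrite -scalemxAl -scalemxAr -scalerDr hP // scaler0.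
pose E := {fraction {poly F}}.
pose f0 : {rmorphism {poly F} -> F} := horner_eval 0.
pose fE : {rmorphism {poly F} -> E} := @tofrac _.
have hE : krylov (map_mx fE (map_mx polyC v)) (map_mx fE Z) \in unitmx.
  rewrite -map_krylov unitmxE det_map_mx unitfE tofrac_eq0.
  move: hK; rewrite unitmxE unitfE; apply: contraNneq => h.
  have := congr1 (horner_eval 1) h; rewrite -det_map_mx map_krylov ev evZ.
  by rewrite scale1r addrC subrK /horner_eval horner0 => ->.
have hlie : (map_mx fE Z)^T *m map_mx fE JX + map_mx fE JX *m map_mx fE Z = 0.
  by rewrite map_trmx -!map_mxM -map_mxD hZ map_mx0.
apply: leq_trans (cyclic_rank_lie_centralizer hE hlie).
rewrite -map_lie_centralizer_mx.
have -> : lie_centralizer_mx J z = map_mx f0 (lie_centralizer_mx JX Z).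
  by rewrite map_lie_centralizer_mx ev evZ scale0r addr0.
apply: mxrank_map_le => a /eqP; rewrite tofrac_eq0 => /eqP ->.
by rewrite rmorph0.
Qed.

(** * Existence of cyclic elements for a nondegenerate form *)

Section Hessenberg.
Variable F : fieldType.

(** The first basis vector is cyclic: its images under successive powers of [c] form a triangular
    matrix whose diagonal entries are products of superdiagonal entries. *)
Lemma hessenberg_cyclic N (c : 'M[F]_N) :
  (forall i j : 'I_N, (i.+1 < j)%N -> c i j = 0) ->
  (forall i j : 'I_N, j = i.+1 :> nat -> c i j != 0) ->
  exists v, krylov v c \in unitmx.
Proof.
case: N c => [|N] c c0 c1; first by exists 0; rewrite unitmxE det_mx00 unitr1.
exists (delta_mx 0 0).
pose e k : 'rV[F]_N.+1 := delta_mx 0 0 *m c ^+ k.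
have eS k : e k.+1 = e k *m c by rewrite /e exprSr mulmxA.
have e0 k (j : 'I_N.+1) : (k < j)%N -> e k 0 j = 0.
  elim: k j => [|k IH] j hj.
    by rewrite /e expr0 mulmx1 !mxE /=; case: eqP => // hj'; rewrite hj' in hj.
  rewrite eS mxE big1 // => l _; have [hl|hl] := ltnP k l.
    by rewrite IH // mul0r.
  by rewrite c0 ?mulr0 //; lia.
have e1 k (j : 'I_N.+1) : k = j :> nat -> e k 0 j != 0.
  elim: k j => [|k IH] j hj.
    have -> : j = 0 by apply/val_inj.
    by rewrite /e expr0 mulmx1 !mxE !eqxx oner_eq0.
  have hk : (k < N.+1)%N by have := ltn_ord j; lia.
  rewrite eS mxE (bigD1 (Ordinal hk)) //= big1 ?addr0.
    by rewrite mulf_neq0 ?IH ?c1 //=; lia.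
  move=> l /eqP hl; have [hl'|hl'] := ltnP k l; first by rewrite e0 // mul0r.
  have : (l : nat) <> k by move=> h; apply: hl; apply: val_inj.
  by move=> h; rewrite c0 ?mulr0 //; lia.
rewrite unitmxE det_trig ?unitfE; last first.
  by apply/is_trig_mxP => i j hij; rewrite mxE; apply: e0.
by apply/prodf_neq0 => i _; rewrite mxE; apply: e1.
Qed.

Lemma monomial_unit k (s : 'I_k -> 'I_k) (g : 'I_k -> F) :
  involutive s -> (forall i, g i != 0) ->
  (\matrix_(i, j) (g i *+ (j == s i)) : 'M_k) \in unitmx.
Proof.
move=> hs hg; rewrite -row_free_unit; apply/inj_row_free => v hv.
apply/rowP => i; have := congr1 (fun u : 'rV_k => u 0 (s i)) hv.
rewrite /= !mxE (bigD1 i) //= big1 ?addr0.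
  by rewrite mxE eqxx mulr1n => /eqP; rewrite mulf_eq0 (negPf (hg i)) orbF => /eqP.
by move=> l hl; rewrite mxE (can_eq hs) eq_sym (negPf hl) mulr0.
Qed.

(** In the basis [V] the form has a monomial Gram matrix G, and c = G^-1 B lies in its Lie algebra
    because [B] has the symmetry opposite to G. Multiplying by G^-1 only permutes and rescales the
    rows of [B], so the conditions on [B] say that c is Hessenberg; it is then carried back to [J]
    by the change of basis. *)
Lemma monomial_cyclic N (J V B : 'M[F]_N) (s : 'I_N -> 'I_N) (g : 'I_N -> F) eps :
  J^T = eps *: J -> B^T = - eps *: B -> eps * eps = 1 ->
  involutive s -> (forall i, g i != 0) ->
  V *m J *m V^T = \matrix_(i, j) (g i *+ (j == s i)) ->
  (forall i j : 'I_N, (i.+1 < j)%N -> B (s i) j = 0) ->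
  (forall i j : 'I_N, j = i.+1 :> nat -> B (s i) j != 0) ->
  exists2 c, c^T *m J + J *m c = 0 & exists v, krylov v c \in unitmx.
Proof.
set G := \matrix_(i, j) _ => hJ hB heps hs hg hV hB0 hB1.
pose c : 'M[F]_N := \matrix_(i, j) (B (s i) j / g (s i)).
have hGc : G *m c = B.
  apply/matrixP => i j; rewrite mxE (bigD1 (s i)) //= big1 ?addr0.
    by rewrite !mxE eqxx mulr1n hs mulrC divfK.
  by move=> l hl; rewrite mxE (negPf hl) mul0r.
have hG : G^T = eps *: G.
  by rewrite -hV !trmx_mul trmxK hJ -scalemxAl -scalemxAr mulmxA.
have hc : c^T *m G + G *m c = 0.
  rewrite hGc -[G]trmxK -trmx_mul hG -scalemxAl hGc linearZ /= hB scalerA.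
  by rewrite mulrN heps scaleN1r addNr.
have uV : V^T \in unitmx.
  have := monomial_unit hs hg; rewrite -/G -hV !unitmxE !det_mulmx det_tr.
  by rewrite !unitfE !mulf_eq0 !negb_or => /andP[].
have uV' : V \in unitmx by rewrite -unitmx_tr.
have hJ' : J = invmx V *m G *m invmx V^T.
  by rewrite -hV !mulmxA mulVmx // mul1mx mulmxK.
have [v hv] : exists v, krylov v c \in unitmx.
  apply: hessenberg_cyclic => i j hij; rewrite mxE; first by rewrite hB0 ?mul0r.
  by rewrite mulf_neq0 ?invr_eq0 ?hB1.
exists (V^T *m c *m invmx V^T).
  rewrite hJ' !trmx_mul trmx_inv !trmxK !mulmxA.
  rewrite mulmxK // mulmxKV //.
  by rewrite -!mulmxA -!mulmxDr !mulmxA -!mulmxDl hc mul0mx mulmx0.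
exists (v *m invmx V^T).
suff -> : krylov (v *m invmx V^T) (V^T *m c *m invmx V^T) =
    krylov v c *m invmx V^T by rewrite unitmx_mul hv unitmx_inv.
apply/row_matrixP => i; rewrite row_mul !rowK.
suff -> : (V^T *m c *m invmx V^T) ^+ i = V^T *m c ^+ i *m invmx V^T.
  by rewrite !mulmxA mulmxKV.
elim: (val i) => [|k IH]; first by rewrite !expr0 mulmx1 mulmxV.
by rewrite !exprSr IH -[_ * (_ *m _)]/(_ *m _) -[_ * c]/(_ *m c) !mulmxA mulmxKV.
Qed.

(** The orthogonal complement of a proper nondegenerate subspace is nonzero and, together with that
    subspace, spans everything. Were the form zero on the complement, the complement would be
    orthogonal to the whole space. *)
Lemma orthogonal_nonzero k N (J : 'M[F]_N) (V : 'M[F]_(k, N)) :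
  J \in unitmx -> V *m J *m V^T \in unitmx -> (k < N)%N ->
  exists w w' : 'rV[F]_N, [/\ w *m J *m V^T = 0, w' *m J *m V^T = 0
    & w *m J *m w'^T != 0].
Proof.
move=> uJ uV hk; set W := kermx (J *m V^T).
have hW : W *m J *m V^T = 0 by rewrite -mulmxA mulmx_ker.
have hW0 : W != 0.
  rewrite -mxrank_eq0 mxrank_ker; have := rank_leq_col (J *m V^T); lia.
have hWJ : W *m J *m W^T != 0.
  apply: contraNneq hW0 => h; set D := V *m J *m V^T in uV *.
  pose A := J *m V^T *m invmx D.
  (* [A *m V] is the projection onto the span of [V] along its orthogonal complement. *)
  have : (1%:M - A *m V <= W)%MS.
    apply/sub_kermxP; rewrite mulmxBl mul1mx /A -!mulmxA [V *m _]mulmxA -/D.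
    by rewrite mulVmx // mulmx1 subrr.
  case/submxP => C /eqP; rewrite subr_eq => /eqP hC.
  have : W *m J = 0.
    rewrite -[W *m J]mulmx1 -trmx1 hC linearD /= [(C *m W)^T]trmx_mul.
    rewrite [(A *m V)^T]trmx_mul mulmxDr ![W *m J *m (_ *m _)]mulmxA h hW.
    by rewrite !mul0mx addr0.
  by move/(canRL (mulmxK uJ)); rewrite mul0mx => ->.
have [i [j hij]] : exists i j, (W *m J *m W^T) i j != 0.
  move/negP: hWJ; apply: contra_notP => h; apply/eqP/matrixP => i j.
  by rewrite [RHS]mxE; apply: contra_notP h => /eqP ?; exists i, j.
exists (row i W), (row j W); rewrite -!row_mul hW !row0; split=> //.
apply: contraNneq hij; move: (W *m J) => U /matrixP/(_ 0 0).
by rewrite !mxE => {2}<-; apply/eqP/eq_bigr => l _; rewrite !mxE.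
Qed.

Lemma mx11_eq0 (A : 'M[F]_1) : (A == 0) = (A 0 0 == 0).
Proof.
apply/eqP/eqP => [->|h]; first by rewrite mxE.
by apply/matrixP => i j; rewrite !ord1 h mxE.
Qed.

Lemma bilinear_tr N (J : 'M[F]_N) eps (u v : 'rV[F]_N) : J^T = eps *: J ->
  v *m J *m u^T = eps *: (u *m J *m v^T).
Proof.
move=> hJ; have <- : (v *m J *m u^T)^T = v *m J *m u^T.
  by apply/matrixP => i j; rewrite !ord1 mxE.
by rewrite !trmx_mul trmxK hJ mulmxA -scalemxAr -scalemxAl.
Qed.

Lemma orthogonal_basis N (J : 'M[F]_N) :
  (2%:R : F) != 0 -> J \in unitmx -> J^T = J ->
  forall k, (k <= N)%N -> exists (V : 'M[F]_(k, N)) (d : 'rV[F]_k),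
    V *m J *m V^T = diag_mx d /\ forall i, d 0 i != 0.
Proof.
move=> two uJ hJ; elim=> [|k IH] hk.
  by exists 0, 0; split=> [|[]//]; apply/matrixP => -[].
have [V [d [hV hd]]] := IH (ltnW hk).
have uV : V *m J *m V^T \in unitmx.
  rewrite hV unitmxE det_diag unitfE; exact/prodf_neq0.
have [w [w' [hw hw' hww']]] := orthogonal_nonzero uJ uV hk.
have hJ1 : J^T = 1 *: J by rewrite scale1r.
have [u [hu hu0]] : exists u : 'rV_N, u *m J *m V^T = 0 /\ u *m J *m u^T != 0.
  have [h|h] := eqVneq (w *m J *m w^T) 0; last by exists w.
  have [h'|h'] := eqVneq (w' *m J *m w'^T) 0; last by exists w'.
  (* Both vectors are isotropic, so by polarization the form takes at [w + w'] twice its value on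
     the pair. *)
  exists (w + w'); rewrite !mulmxDl hw hw' addr0; split=> //.
  rewrite linearD /= !mulmxDr h h' addr0 add0r (bilinear_tr w w' hJ1) scale1r.
  by rewrite -mulr2n -scaler_nat scaler_eq0 negb_or two.
pose V' : 'M_(1 + k, N) := col_mx u V.
pose d' : 'rV_(1 + k) := row_mx (u *m J *m u^T) d.
have hV' : V' *m J *m V'^T = diag_mx d'.
  have hVu : V *m J *m u^T = 0.
    by apply: trmx_inj; rewrite !trmx_mul trmxK hJ mulmxA hu trmx0.
  rewrite mul_col_mx tr_col_mx mul_col_row hu hV hVu diag_mx_row; congr block_mx.
  by apply/matrixP => i j; rewrite !ord1 [RHS]mxE eqxx mulr1n.
have hd' (i : 'I_(1 + k)) : d' 0 i != 0.
  case: (split_ordP i) => l ->; last by rewrite row_mxEr.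
  by rewrite row_mxEl ord1 -mx11_eq0.
by exists V', d'.
Qed.

(** Exchanges the two members of each hyperbolic pair in a symplectic basis. *)
Definition flip i := if odd i then i.-1 else i.+1.

Lemma flipK : involutive flip.
Proof. by move=> i; rewrite /flip; case: (boolP (odd i)) => ?; case: ifP; lia. Qed.

Lemma flipSS i : flip i.+2 = (flip i).+2.
Proof. by rewrite /flip /= negbK; case: ifP; lia. Qed.

Lemma flip_ltn m i : (i < m.*2)%N -> (flip i < m.*2)%N.
Proof. by rewrite /flip; case: ifP; lia. Qed.

Lemma symplectic_basis N (J : 'M[F]_N) :
  (2%:R : F) != 0 -> J \in unitmx -> J^T = - J ->
  forall m, (m.*2 <= N)%N -> exists (V : 'M[F]_(m.*2, N)) (g : 'I_(m.*2) -> F),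
    V *m J *m V^T = \matrix_(i, j) (g i *+ (j == flip i :> nat)) /\
    forall i, g i != 0.
Proof.
move=> two uJ hJ; elim=> [|m IH] hm.
  by exists 0, (fun=> 0); split=> [|[]//]; apply/matrixP => -[].
have [|V [g [hV hg]]] := IH; first by rewrite doubleS in hm; lia.
pose s (i : 'I_(m.*2)) := Ordinal (flip_ltn (ltn_ord i)).
have hs : involutive s by move=> i; apply: val_inj; rewrite /= flipK.
have uV : V *m J *m V^T \in unitmx.
  by have := monomial_unit hs hg; rewrite hV.
have hlt : (m.*2 < N)%N by rewrite doubleS in hm; lia.
have [w [w' [hw hw' hww']]] := orthogonal_nonzero uJ uV hlt.
have hJ1 : J^T = (-1) *: J by rewrite scaleN1r.
have h0 (u : 'rV[F]_N) : u *m J *m u^T = 0.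
  have /eqP := bilinear_tr u u hJ1; rewrite scaleN1r -addr_eq0 -mulr2n.
  by rewrite -scaler_nat scaler_eq0 (negPf two) => /eqP.
have hV0 (u : 'rV_N) : u *m J *m V^T = 0 -> V *m J *m u^T = 0.
  by move=> hu; apply: trmx_inj; rewrite !trmx_mul trmxK hJ mulNmx mulmxN mulmxA hu oppr0 trmx0.
set a := (w *m J *m w'^T) 0 0.
have ha : a != 0 by rewrite -mx11_eq0.
(* The values [a] and [- a] belong to the new hyperbolic pair, put in front; the default 0 lies
   outside the index range. *)
pose g' (i : nat) := if i is i'.+2 then odflt 0 (omap g (insub i')) else if i is 1 then - a else a.
pose V' : 'M_(1 + (1 + m.*2), N) := col_mx w (col_mx w' V).
have hV' : V' *m J *m V'^T =
    col_mx (row_mx 0 (row_mx a%:M 0)) (col_mx (row_mx (- a)%:M (row_mx 0 0))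
      (row_mx 0 (row_mx 0 (V *m J *m V^T)))).
  have hw1 : w *m J *m w'^T = a%:M.
    by apply/matrixP => i j; rewrite !ord1 [RHS]mxE eqxx mulr1n.
  have hw2 : w' *m J *m w^T = (- a)%:M.
    by rewrite (bilinear_tr w w' hJ1) hw1 scaleN1r raddfN.
  rewrite /V' !mul_col_mx !tr_col_mx !mul_mx_row.
  by rewrite !h0 hw hw' !hV0 // hw1 hw2.
exists V', (fun i => g' i); split; last first.
  move=> [[|[|i]] hi] //=; first by rewrite oppr_eq0.
  by have hi' : (i < m.*2)%N by []; rewrite insubT /=.
apply: (etrans hV'); rewrite hV; apply/matrixP => i j.
rewrite [RHS]mxE; case: (split_ordP (i : 'I_(1 + (1 + m.*2)))) => {}i ->;
  [rewrite ord1|case: (split_ordP i) => {}i ->; [rewrite ord1|]];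
  (case: (split_ordP (j : 'I_(1 + (1 + m.*2)))) => {}j ->;
  [rewrite ord1|case: (split_ordP j) => {}j ->; [rewrite ord1|]]);
  rewrite ?(col_mxEu, col_mxEd, row_mxEl, row_mxEr) ?mxE //= ?eqxx ?mulr1n //.
all: by rewrite ?add1n add0n flipSS ?valK ?mulr0n //= ?mulr0n.
Qed.

(* In an orthogonal or symplectic basis, J^-1 B is Hessenberg for a suitable   *)
(* tridiagonal (or nearly so) matrix B with B^T = -+ B.                         *)
Lemma cyclic_lie_exists N (J : 'M[F]_N) :
  (2%:R : F) != 0 -> J \in unitmx -> J^T = - J \/ J^T = J ->
  exists2 c, c^T *m J + J *m c = 0 & exists v, krylov v c \in unitmx.
Proof.
move=> two uJ [hJ|hJ].
  have hN : ~~ odd N.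
    apply/negP => hN; move: uJ; rewrite unitmxE unitfE.
    have : \det J *+ 2 = 0.
      rewrite mulr2n -{1}det_tr hJ -scaleN1r detZ -signr_odd hN expr1 mulN1r.
      by rewrite addNr.
    by rewrite -mulr_natr => /eqP; rewrite mulf_eq0 (negPf two) orbF => ->.
  have hN2 : N = N./2.*2 by have := odd_double_half N; lia.
  move: (N./2) hN2 => m hm; subst N.
  have [V [g [hV hg]]] := symplectic_basis two uJ hJ (leqnn _).
  pose s (i : 'I_(m.*2)) := Ordinal (flip_ltn (ltn_ord i)).
  have hs : involutive s by move=> i; apply: val_inj; rewrite /= flipK.
  (* Row [flip i] of this symmetric matrix is supported at column [i.+1] and, for odd [i], possibly
     also at column i - 3. *)
  pose b (i j : nat) : bool := ((i == j) && odd i) ||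
    [&& ~~ odd i, ~~ odd j & ((j == i.+2) || (i == j.+2))].
  apply: (@monomial_cyclic _ J V (\matrix_(i, j) (b i j)%:R) s g (-1)) => //.
  - by rewrite hJ scaleN1r.
  - rewrite opprK scale1r; apply/matrixP => i j; rewrite !mxE; congr (_%:R).
    by rewrite /b; apply/eqP; lia.
  - by rewrite mulN1r opprK.
  - move=> i j hij; rewrite mxE /b /= /flip.
    by case: ifP => hi; rewrite [X in X%:R](_ : _ = 0%N) //; lia.
  - move=> i j hij; rewrite mxE /b /= /flip hij; case: ifP => hi.
      by rewrite [X in X%:R](_ : _ = 1%N) ?oner_eq0 //; lia.
    by rewrite [X in X%:R](_ : _ = 1%N) ?oner_eq0 //; lia.
have [V [d [hV hd]]] := orthogonal_basis two uJ hJ (leqnn _).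
pose B : 'M[F]_N := \matrix_(i, j) ((j == i.+1 :> nat)%:R - (i == j.+1 :> nat)%:R).
apply: (@monomial_cyclic _ J V B id (fun i => d 0 i) 1) => //.
- by rewrite hJ scale1r.
- by apply/matrixP => i j; rewrite !mxE mulN1r opprB.
- by rewrite mul1r.
- by rewrite hV; apply/matrixP => i j; rewrite !mxE eq_sym.
- move=> i j hij; rewrite mxE [X in X%:R - _](_ : _ = 0%N); last by lia.
  by rewrite [X in _ - X%:R](_ : _ = 0%N) ?subrr //; lia.
- move=> i j hij; rewrite mxE hij eqxx [X in _ - X%:R](_ : _ = 0%N); last by lia.
  by rewrite subr0 oner_eq0.
Qed.
End Hessenberg.

(** * Krull dimension and independent monomials *)

Section Dimension.
Variables (F : fieldType) (n : nat).
Implicit Types (Z V : set 'rV[F]_n) (p q : {mpoly F[n]}).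

Lemma irreducible_mul Z p q : irreducible_set Z ->
  (forall v, Z v -> p.@[v 0] * q.@[v 0] = 0) ->
  (forall v, Z v -> p.@[v 0] = 0) \/ (forall v, Z v -> q.@[v 0] = 0).
Proof.
case=> _ hZ hpq.
have [|||h|h] := hZ (zeros [set p]) (zeros [set q]).
- by exists [set p].
- by exists [set q].
- move=> v /hpq /eqP; rewrite mulf_eq0 => /orP[] /eqP h; [left|right];
    by move=> _ ->.
- by left=> v /h; apply.
- by right=> v /h; apply.
Qed.

(* Witnesses dimension at least [d]; the exponent [kappa] makes up for the power *)
(* lost in [rational_power].                                                     *)
Definition independent_monomials Z d kappa (h : nat -> {mpoly F[n]}) : Prop :=
  forall s, exists (I : finType) (alpha : I -> nat -> nat),
    [/\ #|I| = (s ^ d)%N, forall a i, (alpha a i <= s)%N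
      & forall c : I -> F,
          (forall v, Z v ->
            \sum_a c a * \prod_(i < d) (h i).@[v 0] ^+ (kappa * alpha a i) = 0) ->
          forall a, c a = 0].

(** The new function f vanishes on [Z] but not on [Z']. In a relation on [Z'], the lowest power of f
    factors out by irreducibility; restricting the quotient to [Z] leaves a relation among the old
    monomials, so the coefficients at that power vanish. Induction on the power finishes. *)
Lemma independent_monomials_step Z Z' d kappa h :
  (0 < kappa)%N -> irreducible_set Z' -> zariski_closed Z -> Z `<` Z' ->
  independent_monomials Z d kappa h ->
  exists h', independent_monomials Z' d.+1 kappa h'.
Proof.
move=> k0 iZ' [S hS] [hZZ' hZ'Z] hh.
have [f [fZ [v0 [v0Z' v0f]]]] : exists f : {mpoly F[n]},
    (forall v, Z v -> f.@[v 0] = 0) /\ exists v0, Z' v0 /\ f.@[v0 0] <> 0.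
  apply: contra_notP hZ'Z => hf v hv; rewrite hS => p hp.
  apply: contra_notP hf => hpv; exists p; split; last by exists v.
  by move=> w; rewrite hS; apply.
exists (fun i => if i == d then f else h i) => s.
have [I [alpha [cI ha hI]]] := hh s.
exists ('I_s * I)%type, (fun a i => if i == d then val a.1 else alpha a.2 i).
split=> [|a i|c hc].
- by rewrite card_prod card_ord cI expnS.
- by case: ifP => _; [exact: ltnW (ltn_ord a.1)|].
suff H k (lks : (k < s)%N) a : c (Ordinal lks, a) = 0 by case=> -[k lk] a; apply: H.
elim/ltn_ind: k lks a => k IH lks.
pose g a : {mpoly F[n]} := \prod_(i < d) h i ^+ (kappa * alpha a i).
have ev_g v a : (g a).@[v] = \prod_(i < d) (h i).@[v] ^+ (kappa * alpha a i).
  by rewrite rmorph_prod; apply: eq_bigr => i _; rewrite rmorphXn.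
pose Sk : {mpoly F[n]} := \sum_(u : 'I_s * I | (k <= u.1)%N)
  c u *: (f ^+ (kappa * (u.1 - k)) * g u.2).
have [h1|h1] : (forall v, Z' v -> (f ^+ (kappa * k)).@[v 0] = 0) \/
    (forall v, Z' v -> Sk.@[v 0] = 0).
- apply: (irreducible_mul iZ') => v /hc; rewrite rmorphXn => hv.
  rewrite -[RHS]hv rmorph_sum mulr_sumr [RHS](bigID (fun u : 'I_s * I => k <= u.1)%N) /=.
  rewrite [X in _ = _ + X]big1 ?addr0 => [|[[l hl] a] /=]; last first.
    by rewrite -ltnNge => hlk; rewrite IH ?mul0r.
  apply: eq_bigr => u hu; rewrite mevalZ mevalM ev_g rmorphXn /= mulrCA.
  congr (_ * _); rewrite mulrA -exprD -mulnDr subnKC // big_ord_recr /= eqxx.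
  rewrite [RHS]mulrC; congr (_ * _); apply: eq_bigr => i _.
  by have := ltn_ord i; case: eqP => // ->; rewrite ltnn.
- by have := h1 _ v0Z'; rewrite rmorphXn => /eqP; rewrite expf_eq0 => /andP[_ /eqP].
apply: hI => v hv; apply: etrans _ (h1 v (hZZ' _ hv)).
rewrite rmorph_sum /=.
rewrite [RHS](bigID (fun u : 'I_s * I => u.1 == Ordinal lks)) /= [X in _ = _ + X]big1 ?addr0.
  transitivity (\sum_(l < s | l == Ordinal lks) \sum_a
      (c (l, a) *: (f ^+ (kappa * (l - k)) * g a)).@[v 0]).
    rewrite big_pred1_eq; apply: eq_bigr => a _.
    by rewrite mevalZ mevalM subnn muln0 expr0 meval1 mul1r ev_g.
  rewrite pair_big_dep /=; apply: eq_big => [[l a] /=|[l a] _] //.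
  by rewrite andbT andb_idl // => /eqP ->.
move=> u /andP[hk hu]; rewrite mevalZ mevalM rmorphXn /= fZ // expr0n.
have hne : (u.1 : nat) != k by [].
by rewrite muln_eq0 (_ : (_ || _) = false) ?mul0r ?mulr0 //; lia.
Qed.

Lemma dim_ge_independent V d kappa : (0 < kappa)%N -> dim_ge V d ->
  exists Z h, [/\ irreducible_set Z, Z `<=` V & independent_monomials Z d kappa h].
Proof.
move=> k0 [Z [hZ hlt]].
suff H e : (e <= d)%N -> exists h, independent_monomials (Z e) e kappa h.
  have [h hh] := H d (leqnn _); have [_ iZ sZ] := hZ d (leqnn _).
  by exists (Z d), h.
elim: e => [|e IH] hed.
  exists (fun=> 0) => s; exists unit, (fun _ _ => 0%N); split=> //.
    by rewrite card_unit.
  have [_ [[v0 hv0] _] _] := hZ 0%N isT.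
  move=> c /(_ v0 hv0); rewrite (big_pred1 tt) => [|[]//].
  by rewrite big_ord0 mulr1 => c0 [].
have [h hh] := IH (ltnW hed).
have [_ iZ' _] := hZ e.+1 hed; have [cZ _ _] := hZ e (ltnW hed).
exact: (independent_monomials_step k0 iZ' cZ (hlt e hed) hh).
Qed.

Lemma dim_geW V d e : (e <= d)%N -> dim_ge V d -> dim_ge V e.
Proof.
move=> hed [Z [hZ hlt]]; exists Z; split=> l hl.
  exact: hZ (leq_trans hl hed).
exact: hlt (leq_trans hl hed).
Qed.
End Dimension.

(** The size bound forces every exponent below [B], so the coefficient vectors live in dimension
    [B ^ D]. *)
Lemma card_independent_mpoly (F : fieldType) D B (I : finType)
    (P : I -> {mpoly F[D]}) :
  (forall a, msize (P a) <= B)%N ->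
  (forall c : I -> F, \sum_a c a *: P a = 0 -> forall a, c a = 0) ->
  (#|I| <= B ^ D)%N.
Proof.
move=> hB hP; pose T := {ffun 'I_D -> 'I_B}.
pose mon (b : T) : 'X_{1..D} := [multinom (b i : nat) | i < D].
pose A := \matrix_(i < #|I|, b < #|T|) (P (enum_val i))@_(mon (enum_val b)).
have <- : #|T| = (B ^ D)%N by rewrite card_ffun !card_ord.
suff : row_free A by rewrite /row_free => /eqP <-; apply: rank_leq_col.
apply/inj_row_free => v hv; apply/rowP => i; rewrite mxE.
rewrite -[i]enum_valK; apply: (hP (fun a => v 0 (enum_rank a))).
apply/mpolyP => m; rewrite mcoeff0 raddf_sum /=.
under eq_bigr do rewrite mcoeffZ.
have [hm|hm] := leqP B (mdeg m).
  rewrite big1 // => a _; rewrite memN_msupp_eq0 ?mulr0 //.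
  by rewrite msize_mdeg_ge // (leq_trans (hB a)).
have hmi l : (m l < B)%N.
  by apply: leq_ltn_trans hm; rewrite mdegE (bigD1 l) //= leq_addr.
pose b : T := [ffun l => Ordinal (hmi l)].
have mb : mon b = m by apply/mnmP => l; rewrite mnmE ffunE.
have := congr1 (fun u : 'rV_#|T| => u 0 (enum_rank b)) hv; rewrite !mxE => h.
apply: etrans _ h; rewrite (reindex (@enum_val I I)) /=; last first.
  by apply: onW_bij; apply: enum_val_bij.
by apply: eq_bigr => l _; rewrite mxE !enum_rankK mb enum_valK.
Qed.

Lemma exponent_le d n E : (forall s, (0 < s)%N -> s ^ d <= (s * E) ^ n)%N -> (d <= n)%N.
Proof.
move=> h; rewrite leqNgt; apply/negP => hnd.
(* If n < d, this choice gives s^d >= s^n s > s^n E^n. *)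
pose s := (E ^ n).+1.
have := h s isT; apply/negP; rewrite -ltnNge expnMn.
apply: leq_trans (leq_pexp2l _ hnd) => //.
by rewrite expnSr ltn_pmul2l ?expn_gt0.
Qed.

(** * Rings of functions *)

Section FunctionRing.
Variables (R : comPzRingType) (T : Type).

(** A subring of functions containing the constants. Membership in such a ring replaces explicit
    polynomials: determinants, adjugates and compositions stay inside by closure. *)
Definition function_ring (P : (T -> R) -> Prop) : Prop :=
  [/\ forall a, P (fun=> a),
      forall f g, P f -> P g -> P (fun t => f t + g t)
    & forall f g, P f -> P g -> P (fun t => f t * g t)].

Variable P : (T -> R) -> Prop.
Hypothesis ringP : function_ring P.

Lemma fring_eq f g : P f -> f =1 g -> P g.
Proof. by move=> + /funext <-. Qed.

Lemma fring_cst a : P (fun=> a). Proof. by case: ringP. Qed.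

Lemma fring_add f g : P f -> P g -> P (fun t => f t + g t).
Proof. by case: ringP => _ + _; apply. Qed.

Lemma fring_mul f g : P f -> P g -> P (fun t => f t * g t).
Proof. by case: ringP => _ _; apply. Qed.

Lemma fring_opp f : P f -> P (fun t => - f t).
Proof.
by move=> hf; apply: (fring_eq (fring_mul (fring_cst (-1)) hf)) => t; rewrite mulN1r.
Qed.

Lemma fring_sum I (s : seq I) (Q : pred I) (f : I -> T -> R) :
  (forall i, P (f i)) -> P (fun t => \sum_(i <- s | Q i) f i t).
Proof.
move=> hf; elim: s => [|i s IH].
  by apply: (fring_eq (fring_cst 0)) => t; rewrite big_nil.
case hi: (Q i); last by apply: (fring_eq IH) => t; rewrite big_cons hi.
by apply: (fring_eq (fring_add (hf i) IH)) => t; rewrite big_cons hi.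
Qed.

Lemma fring_prod I (s : seq I) (Q : pred I) (f : I -> T -> R) :
  (forall i, P (f i)) -> P (fun t => \prod_(i <- s | Q i) f i t).
Proof.
move=> hf; elim: s => [|i s IH].
  by apply: (fring_eq (fring_cst 1)) => t; rewrite big_nil.
case hi: (Q i); last by apply: (fring_eq IH) => t; rewrite big_cons hi.
by apply: (fring_eq (fring_mul (hf i) IH)) => t; rewrite big_cons hi.
Qed.

Lemma fring_exp f k : P f -> P (fun t => f t ^+ k).
Proof.
move=> hf; elim: k => [|k IH]; first exact: (fring_eq (fring_cst 1)).
by apply: (fring_eq (fring_mul hf IH)) => t; rewrite exprS.
Qed.

Definition function_mx m n (M : T -> 'M[R]_(m, n)) : Prop :=
  forall i j, P (fun t => M t i j).

Lemma fmx_cst m n (A : 'M[R]_(m, n)) : function_mx (fun=> A).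
Proof. by move=> i j; apply: fring_cst. Qed.

Lemma fmx_add m n (A B : T -> 'M[R]_(m, n)) :
  function_mx A -> function_mx B -> function_mx (fun t => A t + B t).
Proof.
by move=> hA hB i j; apply: (fring_eq (fring_add (hA i j) (hB i j))) => t; rewrite mxE.
Qed.

Lemma fmx_scale m n f (A : T -> 'M[R]_(m, n)) :
  P f -> function_mx A -> function_mx (fun t => f t *: A t).
Proof.
by move=> hf hA i j; apply: (fring_eq (fring_mul hf (hA i j))) => t; rewrite mxE.
Qed.

Lemma fmx_opp m n (A : T -> 'M[R]_(m, n)) :
  function_mx A -> function_mx (fun t => - A t).
Proof.
by move=> hA i j; apply: (fring_eq (fring_opp (hA i j))) => t; rewrite mxE.
Qed.

Lemma fmx_tr m n (A : T -> 'M[R]_(m, n)) :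
  function_mx A -> function_mx (fun t => (A t)^T).
Proof. by move=> hA i j; apply: (fring_eq (hA j i)) => t; rewrite mxE. Qed.

Lemma fmx_mul m n p (A : T -> 'M[R]_(m, n)) (B : T -> 'M[R]_(n, p)) :
  function_mx A -> function_mx B -> function_mx (fun t => A t *m B t).
Proof.
move=> hA hB i j; have := fring_sum (index_enum _) xpredT
  (fun l => fring_mul (hA i l) (hB l j)).
by move/fring_eq; apply=> t; rewrite mxE.
Qed.

Lemma fmx_exp n (A : T -> 'M[R]_n) k :
  function_mx A -> function_mx (fun t => A t ^+ k).
Proof.
move=> hA; elim: k => [|k IH] i j; first exact: fring_cst.
by apply: (fring_eq (fmx_mul hA IH i j)) => t; rewrite exprS.
Qed.

Lemma fmx_sum m n I (s : seq I) (f : I -> T -> 'M[R]_(m, n)) :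
  (forall i, function_mx (f i)) -> function_mx (fun t => \sum_(i <- s) f i t).
Proof.
move=> hf i j; have := fring_sum s xpredT (fun l => hf l i j).
by move/fring_eq; apply=> t; rewrite summxE.
Qed.

Lemma fring_det n (A : T -> 'M[R]_n) : function_mx A -> P (fun t => \det (A t)).
Proof.
move=> hA; apply: fring_sum => s; apply: fring_mul; first exact: fring_cst.
by apply: fring_prod => i; apply: hA.
Qed.

Lemma fmx_adj n (A : T -> 'M[R]_n) :
  function_mx A -> function_mx (fun t => \adj (A t)).
Proof.
move=> hA i j.
have h : P (fun t => cofactor (A t) j i).
  apply: fring_mul; first exact: fring_cst.
  apply: fring_det => a b; apply: (fring_eq (hA (lift j a) (lift i b))) => t.
  by rewrite !mxE.
by apply: (fring_eq h) => t; rewrite mxE.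
Qed.
End FunctionRing.

Lemma function_ring_meval (F : fieldType) (T : Type) (P : (T -> F) -> Prop) n
    (b : T -> 'I_n -> F) (p : {mpoly F[n]}) :
  function_ring P -> (forall i, P (fun t => b t i)) -> P (fun t => p.@[b t]).
Proof.
move=> ringP hb.
apply: (@fring_eq _ _ _ (fun t => \sum_(m <- msupp p) p@_m * \prod_i b t i ^+ m i));
  last by move=> t; rewrite mevalE.
apply: (fring_sum ringP) => m; apply: (fring_mul ringP); first exact: fring_cst.
by apply: (fring_prod ringP) => i; apply: (fring_exp ringP).
Qed.

Definition polynomial_function (F : fieldType) (T : Type) n (b : T -> 'rV[F]_n)
    (f : T -> F) : Prop :=
  exists p : {mpoly F[n]}, forall t, f t = p.@[b t 0].

Lemma polynomial_function_ring (F : fieldType) T n (b : T -> 'rV[F]_n) :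
  function_ring (polynomial_function b).
Proof.
split=> [a|f g [p hp] [q hq]|f g [p hp] [q hq]].
- by exists a%:MP => t; rewrite mevalC.
- by exists (p + q) => t; rewrite mevalD hp hq.
- by exists (p * q) => t; rewrite mevalM hp hq.
Qed.

Definition univariate_function (F : fieldType) (f : F -> F) : Prop :=
  exists p : {poly F}, forall s, f s = p.[s].

Lemma univariate_function_ring (F : fieldType) :
  function_ring (@univariate_function F).
Proof.
split=> [a|f g [p hp] [q hq]|f g [p hp] [q hq]].
- by exists a%:P => t; rewrite hornerC.
- by exists (p + q) => t; rewrite hornerD hp hq.
- by exists (p * q) => t; rewrite hornerM hp hq.
Qed.

(** The ring P[s], with one auxiliary variable s that [rational_power] later eliminates. *)
Definition function_adjoin (F : fieldType) (T : Type) (P : (T -> F) -> Prop)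
    (f : T * F -> F) : Prop :=
  exists E (b : nat -> T -> F), (forall j, P (b j)) /\
    forall u, f u = \sum_(j < E) b j u.1 * u.2 ^+ j.

Lemma function_adjoin_ring (F : fieldType) T (P : (T -> F) -> Prop) :
  function_ring P -> function_ring (function_adjoin P).
Proof.
move=> ringP.
have poly (b : nat -> T -> F) E (hE : forall j, P (b j)) : exists b', [/\ forall j, P (b' j),
    forall j t, (E <= j)%N -> b' j t = 0 & forall u : T * F,
    \sum_(j < E) b j u.1 * u.2 ^+ j = \sum_(j < E) b' j u.1 * u.2 ^+ j].
  exists (fun j => if (j < E)%N then b j else fun=> 0); split=> [j|j t hj|u].
  - by case: ifP => // _; apply: fring_cst.
  - by rewrite ltnNge hj.
  - by apply: eq_bigr => j _; rewrite ltn_ord.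
have polyE (b : nat -> T -> F) E t s : (forall j t, (E <= j)%N -> b j t = 0) ->
    \sum_(j < E) b j t * s ^+ j = (\poly_(j < E) b j t).[s].
  by move=> h; rewrite horner_poly.
split=> [a|f g [E [b [hb hf]]] [E' [b' [hb' hg]]]|f g [E [b [hb hf]]] [E' [b' [hb' hg]]]].
- exists 1%N, (fun _ _ => a); split=> [j|u]; first exact: fring_cst.
  by rewrite big_ord1 expr0 mulr1.
- have [c [hc c0 ec]] := poly b E hb; have [c' [hc' c0' ec']] := poly b' E' hb'.
  exists (maxn E E'), (fun j t => c j t + c' j t); split=> [j|u].
    exact: fring_add.
  have widen (d : nat -> T -> F) e : (e <= maxn E E')%N ->
      (forall j t, (e <= j)%N -> d j t = 0) ->
      \sum_(j < maxn E E') d j u.1 * u.2 ^+ j = \sum_(j < e) d j u.1 * u.2 ^+ j.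
    move=> he d0; rewrite (big_ord_widen _ (fun j => d j u.1 * u.2 ^+ j) he).
    rewrite [LHS](bigID (fun j : 'I__ => j < e)%N) /= [X in _ + X]big1 ?addr0 //.
    by move=> j; rewrite -leqNgt => hj; rewrite d0 // mul0r.
  under eq_bigr do rewrite mulrDl.
  by rewrite big_split /= (widen c E) ?(widen c' E') ?leq_maxl ?leq_maxr // -ec -ec' hf hg.
- have [c [hc c0 ec]] := poly b E hb; have [c' [hc' c0' ec']] := poly b' E' hb'.
  exists (E + E').-1, (fun j t => \sum_(l < j.+1) c l t * c' (j - l)%N t).
  split=> [j|u].
    by apply: (fring_sum ringP) => l; apply: fring_mul.
  rewrite hf hg ec ec' !polyE // -hornerM.
  set p := \poly_(j < E) _; set q := \poly_(j < E') _.
  rewrite (@horner_coef_wide _ (E + E').-1).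
    apply: eq_bigr => j _; rewrite coefM; congr (_ * _); apply: eq_bigr => l _.
    rewrite !coef_poly; case: ltnP => h1; last by rewrite c0 // !mul0r.
    by case: ltnP => // h2; rewrite c0' // !mulr0.
  have hp : (size p <= E)%N := size_poly _ _.
  have hq : (size q <= E')%N := size_poly _ _.
  apply: leq_trans (size_polyMleq _ _) _.
  by rewrite -!subn1 leq_sub2r // leq_add.
Qed.

(** * Elimination *)

(** The characteristic polynomial of [C] divides a power of p - a, so p(C) - a is nilpotent by
    Cayley-Hamilton and [a] is the only eigenvalue of p(C). *)
Lemma det_horner_mx_const (F : closedFieldType) k (C : 'M[F]_k.+1) (p : {poly F}) a :
  (forall s, root (char_poly C) s -> p.[s] = a) ->
  \det (horner_mx C p) = a ^+ k.+1.
Proof.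
move=> hp; set B := horner_mx C p.
have prod_dvd (s : seq F) (q : {poly F}) : (forall z, z \in s -> 'X - z%:P %| q) ->
    \prod_(z <- s) ('X - z%:P) %| q ^+ size s.
  elim: s => [|z s IH] h; first by rewrite big_nil expr0 dvdpp.
  rewrite big_cons exprS dvdp_mul ?h ?mem_head // IH // => w hw.
  by apply: h; rewrite in_cons hw orbT.
have closed_prod (q : {poly F}) : q \is monic ->
    exists2 s : seq F, q = \prod_(z <- s) ('X - z%:P) & forall z, z \in s -> root q z.
  move=> mq; have [s hs] := closed_field_poly_normal q.
  have hs' : q = \prod_(z <- s) ('X - z%:P) by rewrite hs (monicP mq) scale1r.
  by exists s => // z hz; rewrite hs' root_prod_XsubC.
have hN : (B - a%:M) ^+ k.+1 = 0.
  have [s hs hsr] := closed_prod _ (char_poly_monic C).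
  have hsz : size s = k.+1.
    by have := size_char_poly C; rewrite hs size_prod_XsubC => -[].
  have /dvdpP[q hq] : char_poly C %| (p - a%:P) ^+ k.+1.
    rewrite {1}hs -hsz; apply: prod_dvd => z hz.
    by rewrite dvdp_XsubCl rootE hornerD hornerN hornerC hp ?subrr // hsr.
  have := congr1 (horner_mx C) hq.
  by rewrite rmorphXn rmorphB /= horner_mx_C rmorphM /= Cayley_Hamilton mulr0.
have [s hs hsr] := closed_prod _ (char_poly_monic B).
have hsa z : z \in s -> z = a.
  move=> /hsr; rewrite -eigenvalue_root_char => /eigenvalueP[v hv v0].
  have hvN i : v *m (B - a%:M) ^+ i = (z - a) ^+ i *: v.
    elim: i => [|i IH]; first by rewrite !expr0 mulmx1 scale1r.
    rewrite exprSr mulmxA IH -scalemxAl mulmxBr hv mul_mx_scalar -scalerBl.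
    by rewrite scalerA exprSr.
  apply/eqP; rewrite -subr_eq0.
  have /eqP := hvN k.+1; rewrite hN mulmx0 eq_sym scaler_eq0 (negPf v0) orbF.
  by rewrite expf_eq0 => /andP[].
have hsz : size s = k.+1.
  by have := size_char_poly B; rewrite hs size_prod_XsubC => -[].
have := char_poly_det B; rewrite hs -horner_coef0 horner_prod.
rewrite (eq_big_seq (fun=> - a)); last first.
  by move=> z hz; rewrite hornerXsubC (hsa z hz) sub0r.
rewrite big_const_seq count_predT iter_mulr_1 hsz [(- a) ^+ _]exprNn => /mulrI <- //.
by rewrite unitrX // unitrN1.
Qed.

Lemma char_poly_companion (F : fieldType) k (p : {poly F}) :
  p \is monic -> size p = k.+2 ->
  char_poly (\matrix_(i < k.+1, j < k.+1)
    if i == k :> nat then - p`_j else (i.+1 == j)%:R) = p.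
Proof.
move=> mp hp; have := companionmxK mp; rewrite /companionmx.
have -> : (size p).-2 = (size p).-1.-1 by [].
have -> : (size p).-1 = k.+1 by rewrite hp.
by move=> e; rewrite -[RHS]e.
Qed.

(* [phi] is obtained by eliminating s from [Phi (t, s)] and [h.[s] * c t = 1];  *)
(* the power k.+1 comes from the norm of [Phi (t, _)] modulo [h - (c t)^-1].   *)
Lemma rational_power (F : closedFieldType) T (P : (T -> F) -> Prop) k
    (h : {poly F}) (c phi : T -> F) (Phi : T * F -> F) :
  function_ring P -> size h = k.+2 -> P c -> function_adjoin P Phi ->
  (forall t s, h.[s] * c t = 1 -> Phi (t, s) = phi t) ->
  exists e q, P q /\ forall t, c t != 0 -> phi t ^+ k.+1 * c t ^+ e = q t.
Proof.
move=> ringP hh Pc [E [b [Pb hPhi]]] hphi.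
have lh : lead_coef h != 0 by rewrite lead_coef_eq0 -size_poly_eq0 hh.
pose l := (lead_coef h)^-1.
(* This is [c t] times the companion matrix of the monic multiple of h - (c t)^-1; the factor clears
   the denominator, so the entries belong to [P]. *)
pose D (t : T) : 'M[F]_k.+1 := \matrix_(i, j)
  if i == k :> nat then - (l * (c t * h`_j - (j == 0 :> nat)%:R))
  else c t * (i.+1 == j)%:R.
have PD : function_mx P D.
  move=> i j; have [hi|hi] := boolP (i == k :> nat).
    have := fring_opp ringP (fring_mul ringP (fring_cst ringP l) (fring_add ringP
      (fring_mul ringP Pc (fring_cst ringP h`_j))
      (fring_cst ringP (- (j == 0 :> nat)%:R)))).
    by move/fring_eq; apply=> t; rewrite mxE hi.
  have := fring_mul ringP Pc (fring_cst ringP (i.+1 == j)%:R).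
  by move/fring_eq; apply=> t; rewrite mxE (negPf hi).
(* For nonzero [c t] this is (c t)^E Phi(t, C), with C the companion matrix. Its eigenvalues s
   satisfy h(s) c(t) = 1, where [Phi] takes the single value [phi t]. *)
pose M t := \sum_(j < E) (b j t * c t ^+ (E - j)) *: (D t) ^+ j.
exists (E * k.+1)%N, (fun t => \det (M t)); split.
  apply: fring_det => //; apply: fmx_sum => // j; apply: fmx_scale => //.
    by apply: fring_mul => //; apply: fring_exp.
  exact: fmx_exp.
move=> t ct.
pose H := l *: (h - ((c t)^-1)%:P).
have hsz : size H = k.+2.
  rewrite size_scale ?invr_eq0 // size_polyDl ?hh // size_polyN.
  by rewrite (leq_ltn_trans (size_polyC_leq1 _)).
have mH : H \is monic.
  rewrite monicE lead_coefZ lead_coefDl ?mulVf // hh size_polyN.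
  by rewrite (leq_ltn_trans (size_polyC_leq1 _)).
pose C : 'M[F]_k.+1 := \matrix_(i, j) if i == k :> nat then - H`_j else (i.+1 == j)%:R.
have DE : D t = c t *: C.
  apply/matrixP => i j; rewrite !mxE; case: ifP => // _.
  rewrite coefZ coefB coefC [RHS]mulrN [X in _ = - X]mulrCA.
  rewrite [X in _ = - (l * X)]mulrBr; congr (- (_ * (_ - _))).
  by case: eqP; rewrite ?mulr0 // divff.
have hC : char_poly C = H by apply: char_poly_companion.
pose p := \poly_(j < E) b j t.
have ME : M t = c t ^+ E *: horner_mx C p.
  rewrite /p poly_def rmorph_sum /= scaler_sumr; apply: eq_bigr => j _.
  rewrite linearZ /= rmorphXn /= horner_mx_X DE exprZn !scalerA; congr (_ *: _).
  rewrite -mulrA -exprD subnK ?(ltnW (ltn_ord j)) //; ring.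
rewrite ME detZ (@det_horner_mx_const _ _ _ _ (phi t)) ?exprM 1?mulrC //.
move=> s; rewrite hC rootE hornerZ mulf_eq0 invr_eq0 (negPf lh) /= hornerD hornerN hornerC.
rewrite subr_eq0 => /eqP hs.
rewrite -(hphi t s); last by rewrite hs mulVf.
by rewrite hPhi horner_poly.
Qed.

(** * Rings with polynomial operations on affine space *)

(* Models both O/pi^m with a Greenberg structure ([rv_unif] = pi) and a field   *)
(* acting on itself (r = 1 and [rv_unif] = 0).                                  *)
Record ring_variety (R : comPzRingType) (F : closedFieldType) (r : nat) := RingVariety {
  rv_coord :> R -> 'rV[F]_r;
  rv_bij : bijective rv_coord;
  rv_add : exists P : 'I_r -> {mpoly F[r + r]}, forall u v l,
    rv_coord (u + v) 0 l = (P l).@[row_mx (rv_coord u) (rv_coord v) 0];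
  rv_mul : exists P : 'I_r -> {mpoly F[r + r]}, forall u v l,
    rv_coord (u * v) 0 l = (P l).@[row_mx (rv_coord u) (rv_coord v) 0];
  rv_res : {rmorphism R -> F};
  rv_res_poly : exists P : {mpoly F[r]}, forall a, rv_res a = P.@[rv_coord a 0];
  rv_res_surj : forall c, exists a, rv_res a = c;
  rv_unif : R;
  rv_ker : forall a, rv_res a = 0 -> exists b, a = rv_unif * b;
  rv_unif_ann : forall j a, (j <= r)%N ->
    (rv_unif ^+ j * a = 0 <-> exists b, a = rv_unif ^+ (r - j) * b);
  rv_unif_neq0 : rv_unif ^+ r.-1 <> 0
}.

Section RingVariety.
Variables (R : comPzRingType) (F : closedFieldType) (r : nat).
Variable rv : ring_variety R F r.
Let res : {rmorphism R -> F} := rv_res rv.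

Lemma rv_unif_nilpotent : rv_unif rv ^+ r = 0.
Proof.
have [_ h] := @rv_unif_ann _ _ _ rv r 1 (leqnn r).
by rewrite -[LHS]mulr1 h //; exists 1; rewrite subnn mulr1.
Qed.

(** When [v] inverts [u] modulo the nilpotent ideal, the finite geometric series corrects it to an
    exact inverse, polynomially in [u] and [v]. *)
Definition geometric_inverse (u v : R) : R := v * \sum_(i < r) (1 - u * v) ^+ i.

Lemma geometric_inverseP u v : res u * res v = 1 -> u * geometric_inverse u v = 1.
Proof.
move=> huv; rewrite /geometric_inverse mulrA.
have h : (1 - u * v) ^+ r = 0.
  have [b ->] : exists b, 1 - u * v = rv_unif rv * b.
    by apply: rv_ker; rewrite rmorphB rmorphM rmorph1 /= huv subrr.
  by rewrite exprMn rv_unif_nilpotent mul0r.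
have := subrX1 (1 - u * v) r; rewrite h sub0r.
have -> : 1 - u * v - 1 = - (u * v) by rewrite addrAC subrr sub0r.
by rewrite mulNr => /oppr_inj.
Qed.

Lemma rv_unitP u : res u != 0 -> exists v, u * v = 1.
Proof.
move=> hu; have [v hv] := rv_res_surj rv (res u)^-1.
by exists (geometric_inverse u v); apply: geometric_inverseP; rewrite hv divff.
Qed.

Section Regular.
Variables (T : Type) (P : (T -> F) -> Prop).
Hypothesis ringP : function_ring P.

Definition regular (phi : T -> R) : Prop := forall l, P (fun t => rv (phi t) 0 l).

Lemma regular_ring : function_ring regular.
Proof.
have pair f g (Q : {mpoly F[r + r]}) : regular f -> regular g ->
    P (fun t => Q.@[row_mx (rv (f t)) (rv (g t)) 0]).
  move=> hf hg; apply: function_ring_meval => // i.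
  case: (split_ordP i) => l ->.
    by apply: (fring_eq (hf l)) => t; rewrite row_mxEl.
  by apply: (fring_eq (hg l)) => t; rewrite row_mxEr.
split=> [a l|f g hf hg l|f g hf hg l]; first exact: fring_cst.
  have [Q hQ] := rv_add rv.
  by apply: (fring_eq (pair f g (Q l) hf hg)) => t; rewrite hQ.
have [Q hQ] := rv_mul rv.
by apply: (fring_eq (pair f g (Q l) hf hg)) => t; rewrite hQ.
Qed.

Lemma regular_res phi : regular phi -> P (fun t => res (phi t)).
Proof.
move=> hphi; have [Q hQ] := rv_res_poly rv.
by apply: (fring_eq (function_ring_meval Q ringP hphi)) => t; rewrite -hQ.
Qed.
End Regular.

Variables (N n : nat) (phi : 'M[R]_N -> 'rV[F]_n).
Hypothesis phi_entry : forall l, exists i j l', forall X, phi X 0 l = rv (X i j) 0 l'.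

Lemma regular_poly T (P : (T -> F) -> Prop) (M : T -> 'M[R]_N) f :
  function_ring P -> function_mx (regular P) M ->
  polynomial_function phi f -> P (fun t => f (M t)).
Proof.
move=> ringP hM [p hp].
apply: (fring_eq (function_ring_meval p ringP _)); last by move=> t; rewrite hp.
move=> l; have [i [j [l' hl]]] := phi_entry l.
by apply: (fring_eq (hM i j l')) => t; rewrite hl.
Qed.

Definition cayley_num (X : 'M[R]_N) : 'M[R]_N := (1%:M - X) *m \adj (1%:M + X).

Lemma cayley_num_regular T (P : (T -> F) -> Prop) (M : T -> 'M[R]_N) :
  function_ring P -> function_mx (regular P) M ->
  function_mx (regular P) (fun t => cayley_num (M t)).
Proof.
move=> ringP hM; have ringR := regular_ring ringP.
apply: fmx_mul => //.
  by apply: fmx_add => //; [exact: fmx_cst|exact: fmx_opp].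
by apply: fmx_adj => //; apply: fmx_add => //; exact: fmx_cst.
Qed.

(** The inverse of a unit u is polynomial in u and any lift of the inverse of its residue, but no
    polynomial choice of lift is given. Lifts are therefore taken on a line with parameter s, on
    which [res] is a polynomial h(s); since the inverse of u does not depend on s, [rational_power]
    eliminates s at the cost of a power. That power comes from the degree of h, so it is the same
    for all [f] and [M]. *)
Lemma cayley_power : exists k, forall T (P : (T -> F) -> Prop) (M : T -> 'M[R]_N) g0 f,
  function_ring P -> function_mx (regular P) M -> polynomial_function phi f ->
  exists e q, P q /\ forall t v, v * \det (1%:M + M t) = 1 ->
    f (g0 *m (v *: cayley_num (M t))) ^+ k.+1 * res (\det (1%:M + M t)) ^+ e = q t.
Proof.
have [coordV _ coordVK] := rv_bij rv.
(* The coordinate line through 0 and 1: [res] takes the values 0 and 1 on it, hence is a nonconstant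
   polynomial there. *)
pose line (s : F) : R := coordV (rv 0 + s *: (rv 1 - rv 0)).
have lineE s l : rv (line s) 0 l = rv 0 0 l + s * (rv 1 - rv 0) 0 l.
  by rewrite coordVK mxE [X in _ + X]mxE.
have [h hh] : univariate_function (fun s => res (line s)).
  apply: regular_res; first exact: univariate_function_ring.
  move=> l; exists ((rv 0 0 l)%:P + (rv 1 - rv 0) 0 l *: 'X) => s.
  by rewrite lineE hornerD hornerC hornerZ hornerX mulrC.
have line0 : line 0 = 0.
  by apply: (bij_inj (rv_bij rv)); rewrite coordVK scale0r addr0.
have line1 : line 1 = 1.
  by apply: (bij_inj (rv_bij rv)); rewrite coordVK scale1r addrC subrK.
have [k hk] : exists k, size h = k.+2.
  have h0 := hh 0; have h1 := hh 1; rewrite line0 line1 rmorph0 rmorph1 in h0 h1.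
  have [hsz|] := leqP (size h) 1%N; last by case: (size h) => [|[|k]] // _; exists k.
  move: h1; rewrite (size1_polyC hsz) hornerC => h1.
  by move: h0; rewrite (size1_polyC hsz) hornerC -h1 => /eqP; rewrite eq_sym oner_eq0.
exists k => T P M g0 f ringP hM hf.
pose u t := \det (1%:M + M t).
have ringR := regular_ring ringP.
have hu : regular P u.
  by apply: fring_det => //; apply: fmx_add => //; exact: fmx_cst.
pose Q := function_adjoin P; have ringQ : function_ring Q := function_adjoin_ring ringP.
have ringRQ := regular_ring ringQ.
have lift_P g : P g -> Q (fun w => g w.1).
  move=> Pg; exists 1%N, (fun _ => g); split=> // w.
  by rewrite big_ord1 expr0 mulr1.
have hline : regular Q (fun w => line w.2).
  move=> l; exists 2%N, (fun j _ => if j == 0%N then rv 0 0 l else (rv 1 - rv 0) 0 l).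
  split=> [j|w]; first by case: ifP => _; exact: fring_cst.
  by rewrite lineE big_ord_recr big_ord1 /= expr0 mulr1 expr1 mulrC.
have hM' : function_mx (regular Q) (fun w => M w.1).
  by move=> i j l; apply: (lift_P (fun t => rv (M t i j) 0 l)); apply: hM.
have hu' : regular Q (fun w => u w.1).
  by move=> l; apply: (lift_P (fun t => rv (u t) 0 l)); apply: hu.
pose W w := g0 *m (geometric_inverse (u w.1) (line w.2) *: cayley_num (M w.1)).
have hW : function_mx (regular Q) W.
  apply: fmx_mul => //; first exact: fmx_cst.
  apply: (fmx_scale ringRQ); last exact: (cayley_num_regular (M := fun w => M w.1)).
  rewrite /geometric_inverse; apply: (fring_mul ringRQ) => //.
  apply: fring_sum => // i; apply: (fring_exp ringRQ).
  apply: (fring_add ringRQ); first exact: fring_cst.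
  by apply: (fring_opp ringRQ); apply: (fring_mul ringRQ).
pose Phi w := f (W w).
have QPhi : Q Phi by exact: regular_poly.
(* This section is merely set-theoretic: it names the inverse, while regularity comes from the
   line. *)
have [sec hsec] := choice (rv_res_surj rv).
pose inv t := geometric_inverse (u t) (sec (res (u t))^-1).
have [|e [q [Pq hq]]] := rational_power (phi := fun t => f (g0 *m (inv t *: cayley_num (M t))))
  ringP hk (regular_res ringP hu) QPhi.
  move=> t s; rewrite -hh => hs; rewrite /Phi /W /=; congr (f (_ *m (_ *: _))).
  have h1 : u t * geometric_inverse (u t) (line s) = 1.
    by apply: geometric_inverseP; rewrite mulrC.
  have h2 : u t * inv t = 1.
    apply: geometric_inverseP; rewrite hsec divff //; apply/eqP => h0.
    by move/eqP: hs; rewrite h0 mulr0 eq_sym oner_eq0.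
  by rewrite -[LHS]mulr1 -h2 mulrCA mulrA h1 mul1r.
exists e, q; split=> // t v hv.
have ut0 : res (u t) != 0.
  apply/eqP => h0; have := congr1 res hv; rewrite rmorphM /= -/(u t) h0 mulr0 rmorph1.
  by move/eqP; rewrite eq_sym oner_eq0.
rewrite -hq //; congr (f (_ *m (_ *: _)) ^+ _ * _).
have h2 : u t * inv t = 1 by apply: geometric_inverseP; rewrite hsec divff.
by rewrite -[LHS]mulr1 -h2 mulrA hv mul1r.
Qed.
End RingVariety.

(** * The Cayley transform *)

Lemma scaled_adjK (R : comPzRingType) N (A : 'M[R]_N) v : v * \det A = 1 ->
  A *m (v *: \adj A) = 1%:M /\ (v *: \adj A) *m A = 1%:M.
Proof.
move=> hv; rewrite -scalemxAl -scalemxAr mul_mx_adj mul_adj_mx.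
by rewrite scale_scalar_mx hv.
Qed.

Section Cayley.
Variables (o R : comPzRingType) (f : o -> R) (N : nat) (J : 'M[o]_N).
Let JR := map_mx f J.
Variables (Ji : 'M[R]_N) (half : R).
Hypotheses (JiJ : Ji *m JR = 1%:M) (half2 : half *+ 2 = 1).
Variable y : 'M[R]_N.
Let C := cl_centralizer f J y.
Implicit Types (X g : 'M[R]_N).

Lemma cayley_numE X v : v *: cayley_num X = (1%:M - X) *m (v *: \adj (1%:M + X)).
Proof. by rewrite /cayley_num scalemxAr. Qed.

Lemma cayley_commute X Z v : v * \det (1%:M + X) = 1 -> X *m Z = Z *m X ->
  (v *: cayley_num X) *m Z = Z *m (v *: cayley_num X).
Proof.
move=> /scaled_adjK[h1 h2] hXZ; rewrite cayley_numE.
set Ai := _ *: _ in h1 h2 *.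
have hA : (1%:M + X) *m Z = Z *m (1%:M + X) by rewrite mulmxDl mulmxDr mul1mx mulmx1 hXZ.
have hAi : Ai *m Z = Z *m Ai.
  by rewrite -[LHS]mulmx1 -h1 mulmxA -[Ai *m Z *m _]mulmxA -hA mulmxA h2 mul1mx.
rewrite -mulmxA hAi !mulmxA; congr (_ *m _).
by rewrite mulmxBl mulmxBr mul1mx mulmx1 hXZ.
Qed.

Lemma cayley_one_add X v : v * \det (1%:M + X) = 1 ->
  1%:M + v *: cayley_num X = 2%:R *: (v *: \adj (1%:M + X)).
Proof.
move=> /scaled_adjK[h1 h2]; rewrite cayley_numE -{1}h1 -mulmxDl.
by rewrite addrACA subrr addr0 mulmxDl mul1mx scaler_nat mulr2n.
Qed.

Lemma cayley_one_sub X v : v * \det (1%:M + X) = 1 ->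
  1%:M - v *: cayley_num X = X *m (1%:M + v *: cayley_num X).
Proof.
move=> hv; have [h1 h2] := scaled_adjK hv; rewrite (cayley_one_add hv).
rewrite cayley_numE -{1}h1 -mulmxBl opprB [1%:M + X + _]addrC addrA subrK.
by rewrite mulmxDl scaler_nat mulr2n mulmxDr.
Qed.

(** The Cayley transform is an involution; in this form without denominators it recovers [X], up to
    a unit, by a polynomial expression in its transform. *)
Lemma cayley_num_cayley X v : v * \det (1%:M + X) = 1 ->
  cayley_num (v *: cayley_num X) = \det (1%:M + v *: cayley_num X) *: X.
Proof.
move=> hv; rewrite {1}/cayley_num (cayley_one_sub hv) -mulmxA mul_mx_adj.
by rewrite mul_mx_scalar.
Qed.

Lemma cayley_det X v : v * \det (1%:M + X) = 1 ->
  exists w, w * \det (1%:M + v *: cayley_num X) = 1.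
Proof.
move=> hv; have [h1 h2] := scaled_adjK hv.
exists (half ^+ N * \det (1%:M + X)); rewrite (cayley_one_add hv) detZ.
rewrite mulrACA -exprMn mulr_natr half2 expr1n mul1r -det_mulmx h1.
by rewrite det1.
Qed.

Lemma cayley_cayley X v w : v * \det (1%:M + X) = 1 ->
  w * \det (1%:M + v *: cayley_num X) = 1 -> w *: cayley_num (v *: cayley_num X) = X.
Proof. by move=> hv hw; rewrite cayley_num_cayley // scalerA hw scale1r. Qed.

(** With A = 1 + X and B = 1 - X, skewness of [X] reads A^T J = J B. This gives both invariance of
    the form and, by taking determinants, det A = det B, so the transform has determinant 1. *)
Lemma cayley_centralizer X v : v * \det (1%:M + X) = 1 ->
  lie_centralizer JR y X -> C (v *: cayley_num X).
Proof.
move=> hv [hX hXy]; split; last exact: cayley_commute.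
have [h1 h2] := scaled_adjK hv; rewrite cayley_numE.
set Ai := _ *: _ in h1 h2 *; set A := 1%:M + X in h1 h2; set B := 1%:M - X.
have hXJ : X^T *m JR = - (JR *m X) by apply/eqP; rewrite -addr_eq0 hX.
have hA : A^T *m JR = JR *m B.
  by rewrite /A /B linearD /= trmx1 mulmxDl mulmxBr mul1mx mulmx1 hXJ.
have hB : B^T *m JR = JR *m A.
  by rewrite /A /B linearB /= trmx1 mulmxBl mulmxDr mul1mx mulmx1 hXJ opprK.
have hAB : A *m B = B *m A.
  by rewrite {2}/B {1}/B mulmxBr mulmxBl mulmx1 mul1mx mulmxDl mulmxDr mul1mx mulmx1.
split.
  rewrite trmx_mul -!mulmxA [B^T *m _]mulmxA hB -!mulmxA [A *m _]mulmxA hAB.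
  rewrite -[B *m A *m _]mulmxA h1 mulmx1 -/JR -hA mulmxA -trmx_mul h1 trmx1 mul1mx.
  by [].
have hdet : \det B = \det A.
  have := congr1 determinant hA; rewrite !det_mulmx det_tr => h.
  rewrite -[LHS]mul1r -[RHS]mulr1 -(det1 R N) -JiJ det_mulmx.
  by rewrite -mulrA -h; ring.
by rewrite det_mulmx hdet -det_mulmx h1 det1.
Qed.

Lemma centralizer_cayley g v : v * \det (1%:M + g) = 1 -> C g ->
  exists X w, [/\ lie_centralizer JR y X, w * \det (1%:M + X) = 1
    & w *: cayley_num X = g].
Proof.
move=> hv [[hg _] hgy]; have [w hw] := cayley_det hv.
exists (v *: cayley_num g), w; split=> //; last exact: cayley_cayley.
split; last exact: cayley_commute.
have [h1 h2] := scaled_adjK hv; rewrite cayley_numE.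
set Ai := _ *: _ in h1 h2 *; set A := 1%:M + g in h1 h2; set B := 1%:M - g.
have key : B^T *m JR *m A + A^T *m JR *m B = 0.
  have -> : B^T *m JR *m A = JR *m g - g^T *m JR.
    rewrite /A /B [(_ - g)^T]linearB /= trmx1 mulmxBl mul1mx mulmxDr mulmx1 mulmxBl hg.
    by rewrite addrC addrA subrK.
  have -> : A^T *m JR *m B = g^T *m JR - JR *m g.
    rewrite /A /B [(_ + g)^T]linearD /= trmx1 mulmxDl mul1mx mulmxBr mulmx1 mulmxDl hg.
    by rewrite [JR + _]addrC opprD addrACA subrr addr0.
  by rewrite addrA subrK subrr.
have -> : (B *m Ai)^T *m JR + JR *m (B *m Ai) =
    Ai^T *m (B^T *m JR *m A + A^T *m JR *m B) *m Ai.
  rewrite mulmxDr mulmxDl !mulmxA -[_ *m A *m Ai]mulmxA h1 mulmx1.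
  by rewrite -[Ai^T *m A^T]trmx_mul h1 trmx1 mul1mx trmx_mul.
by rewrite key mulmx0 mul0mx.
Qed.

Lemma centralizer_mul g h : C g -> C h -> C (g *m h).
Proof.
move=> [[hg dg] gy] [[hh dh] hy]; split; first split.
- rewrite trmx_mul -!mulmxA [JR *m _]mulmxA [g^T *m _]mulmxA [g^T *m _]mulmxA.
  by rewrite hg mulmxA hh.
- by rewrite det_mulmx dg dh mulr1.
- by rewrite -mulmxA hy mulmxA gy mulmxA.
Qed.

Lemma centralizer_inv g : C g -> exists gi, [/\ C gi, gi *m g = 1%:M & g *m gi = 1%:M].
Proof.
move=> [[hg dg] gy]; have [|h1 h2] := @scaled_adjK _ _ g 1; first by rewrite dg mulr1.
set gi := _ *: _ in h1 h2; exists gi; split=> //; split; first split.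
- rewrite -[in LHS]hg !mulmxA -trmx_mul h1 trmx1 mul1mx -mulmxA h1 mulmx1 //.
- have := congr1 determinant h1; rewrite det_mulmx dg mul1r det1 //.
- rewrite -[LHS]mulmx1 -h1 mulmxA -[gi *m y *m g]mulmxA -gy mulmxA h2 mul1mx //.
Qed.
End Cayley.

(** * Dimension of centralizers *)

Section MpolySize.
Variables (F : fieldType) (D : nat).
Implicit Types p q : {mpoly F[D]}.

Lemma msizeM_leq p q a b : (msize p <= a.+1)%N -> (msize q <= b.+1)%N ->
  (msize (p * q) <= (a + b).+1)%N.
Proof.
have [->|p0] := eqVneq p 0; first by rewrite mul0r msize0.
have [->|q0] := eqVneq q 0; first by rewrite mulr0 msize0.
rewrite msizeM // => h1 h2; rewrite -subn1 leq_subLR.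
  by rewrite (leq_trans (leq_add h1 h2)) // addSn addnS add1n.
Qed.

Lemma msizeX_leq p a k : (msize p <= a.+1)%N -> (msize (p ^+ k) <= (k * a).+1)%N.
Proof.
move=> hp; elim: k => [|k IH]; first by rewrite expr0 msize1.
by rewrite exprS mulSn; apply: msizeM_leq.
Qed.

Lemma msize_prod_leq d (p : nat -> {mpoly F[D]}) (a : nat -> nat) :
  (forall i, msize (p i) <= (a i).+1)%N ->
  (msize (\prod_(i < d) p i) <= (\sum_(i < d) a i).+1)%N.
Proof.
move=> hp; elim: d => [|d IH]; first by rewrite !big_ord0 msize1.
by rewrite !big_ord_recr /=; apply: msizeM_leq.
Qed.
End MpolySize.

Section CentralizerDimension.
Variables (o R : comPzRingType) (F : closedFieldType) (r : nat).
Variables (rv : ring_variety R F r) (f : o -> R) (N : nat) (J : 'M[o]_N).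
Let res : {rmorphism R -> F} := rv_res rv.
Let JR := map_mx f J.
Variables (Ji : 'M[R]_N) (half : R).
Hypotheses (JiJ : Ji *m JR = 1%:M) (half2 : half *+ 2 = 1).
Variables (n : nat) (phi : 'M[R]_N -> 'rV[F]_n).
Hypothesis phi_entry : forall l, exists i j l', forall X, phi X 0 l = rv (X i j) 0 l'.
Hypothesis entry_phi : forall i j l', exists l, forall X, phi X 0 l = rv (X i j) 0 l'.

Section Coordinates.
Variable q : nat.

Definition param (t : 'rV[R]_q) : 'rV[F]_(q * r) :=
  mxvec (\matrix_(i < q) rv (t 0 i)).

Lemma param_entry : function_mx (regular rv (polynomial_function param)) id.
Proof.
move=> i j l; exists 'X_(mxvec_index j l) => t.
by rewrite mevalXU mxvecE mxE [i]ord1.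
Qed.

Lemma param_surj w : exists t, param t = w.
Proof.
have [coordV _ coordVK] := rv_bij rv.
exists (\row_i coordV (row i (vec_mx w))); apply: (can_inj vec_mxK).
by apply/row_matrixP => i; rewrite mxvecK rowK mxE coordVK.
Qed.

(** Polynomial functions on the parameter space form a domain: restrict to the line joining two
    points where the factors are nonzero, and use that an algebraically closed field is infinite. *)
Lemma polynomial_function_mul g h : polynomial_function param g ->
  polynomial_function param h -> (forall t, g t * h t = 0) ->
  (forall t, g t = 0) \/ (forall t, h t = 0).
Proof.
move=> [p hp] [p' hp'] hgh.
have [|/existsNP[t1 h1]] := pselect (forall t, g t = 0); first by left.
right=> t2; apply: contrapT => h2.
pose w s := param t1 + s *: (param t2 - param t1).
have uni (P : {mpoly F[q * r]}) : exists u : {poly F}, forall s, P.@[w s 0] = u.[s].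
  apply: (@function_ring_meval _ _ _ _ (fun s => w s 0) P (univariate_function_ring F)).
  move=> i; exists ((param t1 0 i)%:P + (param t2 - param t1) 0 i *: 'X) => s.
  by rewrite hornerD hornerC hornerZ hornerX mxE [X in _ + X]mxE mulrC.
have [u hu] := uni p; have [u' hu'] := uni p'.
have w0 : w 0 = param t1 by rewrite /w scale0r addr0.
have w1 : w 1 = param t2 by rewrite /w scale1r addrC subrK.
have un0 : u != 0 by apply/eqP => u0; apply: h1; rewrite hp -w0 hu u0 horner0.
have un0' : u' != 0 by apply/eqP => u0; apply: h2; rewrite hp' -w1 hu' u0 horner0.
have /closed_nonrootP[s] : u * u' != 0 by rewrite mulf_neq0.
have [t ht] := param_surj (w s).
by rewrite rootE hornerM -hu -hu' -ht -hp -hp' hgh eqxx.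
Qed.
End Coordinates.

Lemma phi_entry_regular :
  function_mx (regular rv (polynomial_function phi)) id.
Proof.
by move=> i j l'; have [l hl] := entry_phi i j l'; exists 'X_l => X; rewrite mevalXU hl.
Qed.

Variable y : 'M[R]_N.
Let C := cl_centralizer f J y.

(** Take a point g0 of an irreducible subset Z of the centralizer. The points g of Z with 1 + g0^-1
    g invertible are g0 times a Cayley transform, so they are parametrized rationally by q r
    coordinates; translating by g0 ensures that this open part of Z is nonempty. Independent
    monomials on Z then pull back to independent polynomials, and counting them bounds d. *)
Lemma centralizer_dim_le q (B : 'M[R]_(q, N * N)) d :
  (forall X, lie_centralizer JR y X -> exists t, mxvec X = t *m B) ->
  dim_ge (phi @` C) d -> (d <= q * r)%N.
Proof.
move=> hB hdim; have [k hk] := cayley_power phi_entry.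
have [Z [h [iZ ZC hZ]]] := dim_ge_independent (ltn0Sn k) hdim.
have [[v0 Zv0] _] := iZ; have [g0 Cg0 hg0] := ZC _ Zv0.
have [g0i [Cg0i g0iK g0K]] := centralizer_inv Cg0.
pose M (t : 'rV[R]_q) := vec_mx (t *m B).
pose P := polynomial_function (@param q).
have ringP : function_ring P by exact: polynomial_function_ring.
have PM : function_mx (regular rv P) M.
  move=> i j; have := fmx_mul (regular_ring rv ringP) (@param_entry q)
    (fmx_cst (regular_ring rv ringP) B).
  by move/(_ 0 (mxvec_index i j))/fring_eq; apply=> t; rewrite [RHS]mxE.
have hkM i : exists e Q, P Q /\ forall t v, v * \det (1%:M + M t) = 1 ->
    (h i).@[phi (g0 *m (v *: cayley_num (M t))) 0] ^+ k.+1 *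
    res (\det (1%:M + M t)) ^+ e = Q t.
  by apply: (hk _ P M g0 (fun X => (h i).@[phi X 0])) => //; exists (h i).
have [e he] := choice hkM.
have {he} [Q hQ] := choice he.
have [p hp] := choice (fun i => (hQ i).1).
pose u t := \det (1%:M + M t).
have [pc hpc] : P (fun t => res (u t)).
  have ringR := regular_ring rv ringP; apply: (regular_res ringP).
  by apply: (fring_det ringR); apply: (fmx_add ringR) => //; exact: fmx_cst.
pose b i := (msize (p i) + e i * msize pc)%N.
apply: (@exponent_le _ _ (\sum_(i < d) b i).+1) => s s0.
have [I [alpha [cI ha hI]]] := hZ s; rewrite -cI.
(* The pullback of the monomial [a], multiplied by the common denominator
   [pc ^+ (s * \sum_i e i)]. *)
pose PP a := \prod_(i < d) (p i ^+ alpha a i * pc ^+ (e i * (s - alpha a i))).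
apply: (@card_independent_mpoly _ _ _ _ PP) => [a|c hc].
  have : (msize (PP a) <= (\sum_(i < d) s * b i).+1)%N.
    apply: (@msize_prod_leq _ _ d (fun i => p i ^+ alpha a i * pc ^+ (e i * (s - alpha a i)))
      (fun i => (s * b i)%N)) => i.
    have h1 := @msizeX_leq _ _ _ _ (alpha a i) (leqnSn (msize (p i))).
    have h2 := @msizeX_leq _ _ _ _ (e i * (s - alpha a i)) (leqnSn (msize pc)).
    apply: leq_trans (msizeM_leq h1 h2) _; rewrite ltnS mulnDr leq_add //.
      by rewrite leq_mul2r ha orbT.
    by rewrite mulnCA -mulnA leq_mul // leq_mul // leq_subr.
  by move/leq_trans; apply; rewrite -big_distrr /= mulnS; lia.
pose S : {mpoly F[n]} := \sum_a c a *: \prod_(i < d) h i ^+ (k.+1 * alpha a i).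
have SE v : S.@[v] = \sum_a c a * \prod_(i < d) (h i).@[v] ^+ (k.+1 * alpha a i).
  rewrite rmorph_sum; apply: eq_bigr => a _; rewrite /= mevalZ rmorph_prod.
  by congr (_ * _); apply: eq_bigr => i _; rewrite rmorphXn.
have Scay t v : v * u t = 1 -> S.@[phi (g0 *m (v *: cayley_num (M t))) 0] = 0.
  move=> hv; have ut0 : res (u t) != 0.
    apply/eqP => h0; have := congr1 res hv; rewrite rmorphM /= h0 mulr0 rmorph1.
    by move/eqP; rewrite eq_sym oner_eq0.
  set U := res (u t) in ut0; have hQt i := (hQ i).2 t v hv.
  rewrite -/(u t) -/U in hQt; have hpt i := hp i t; have hct := hpc t; rewrite -/U in hct.
  apply/eqP; rewrite -(mulIr_eq0 _ (mulIf (expf_neq0 (s * \sum_(i < d) e i) ut0))).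
  apply/eqP; have := congr1 (fun pp : {mpoly F[q * r]} => pp.@[param t 0]) hc.
  rewrite /= meval0 => h0; apply: etrans _ h0; rewrite SE mulr_suml [RHS]rmorph_sum /=.
  move: U {ut0} hQt hct => U hQt hct; apply: eq_bigr => a _.
  rewrite mevalZ [X in _ = _ * X]rmorph_prod /= -mulrA; congr (_ * _).
  rewrite big_distrr /= expr_sum -big_split /=; apply: eq_bigr => i _.
  rewrite mevalM !rmorphXn /= -hct -hpt -hQt.
  by rewrite exprMn -!exprM -mulrA -exprD -mulnDr subnKC // [(s * _)%N]mulnC.
have [delta hdelta] : polynomial_function phi (fun X => res (\det (1%:M + g0i *m X))).
  have ringphi : function_ring (polynomial_function phi) by exact: polynomial_function_ring.
  have ringR := regular_ring rv ringphi.
  apply: (regular_res ringphi); apply: (fring_det ringR); apply: (fmx_add ringR).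
    exact: fmx_cst.
  by apply: (fmx_mul ringR); [exact: fmx_cst|exact: phi_entry_regular].
have [|hS|hd] := irreducible_mul (p := S) (q := delta) iZ.
- move=> v Zv; have [g Cg <-] := ZC _ Zv; rewrite -hdelta.
  have [->|hne] := eqVneq (res (\det (1%:M + g0i *m g))) 0; first by rewrite mulr0.
  have [v' hv'] := rv_unitP hne; rewrite mulrC in hv'.
  have [X [w [hX hw hg]]] := centralizer_cayley half2 hv' (centralizer_mul Cg0i Cg).
  have [t ht] := hB X hX; have hMX : M t = X by rewrite /M -ht mxvecK.
  have -> : g = g0 *m (w *: cayley_num (M t)) by rewrite hMX hg mulmxA g0K mul1mx.
  by rewrite Scay ?mul0r // /u hMX.
- by apply: hI => v Zv; rewrite -SE hS.
(* At g0 the determinant is 2^N, a unit, so [delta] does not vanish on Z. *)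
- have := hd _ Zv0; rewrite -hg0 -hdelta g0iK -mulr2n -scaler_nat detZ det1 mulr1.
  have h1 : half ^+ N * 2%:R ^+ N = 1 by rewrite -exprMn mulr_natr half2 expr1n.
  move=> h0; have := congr1 res h1.
  by rewrite rmorphM /= h0 mulr0 rmorph1 => /eqP; rewrite eq_sym oner_eq0.
Qed.


(** * Lower bound: a chain of closures of Cayley images *)

Section LowerBound.
Hypothesis phi_surj : forall v, exists X, phi X = v.
Variables (q : nat) (U : 'M[R]_(q, N * N)) (U' : 'M[R]_(N * N, q)) (kappa : nat -> nat).
Hypothesis UU' : U *m U' = 1%:M.
Hypothesis kappa_le : forall i, (kappa i <= r)%N.
Let w := rv_unif rv.
Hypothesis U_lie : forall i : 'I_q,
  lie_centralizer JR y (vec_mx (w ^+ (r - kappa i) *: row i U)).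

(* The e-th term of the chain is the closure of the Cayley image of the         *)
(* submodule of the t *m U with w ^+ stage e i * t 0 i = 0.                     *)
Definition stage e i := minn (kappa i) (e - \sum_(l < i) kappa l).

Lemma sum_stage e m : \sum_(i < m) stage e i = minn e (\sum_(i < m) kappa i).
Proof.
elim: m => [|m IH]; first by rewrite !big_ord0 minn0.
rewrite !big_ord_recr /= IH /stage.
by move: (\sum_(i < m) _) (kappa m) => S K; lia.
Qed.

Lemma stage_le e i : (stage e i <= stage e.+1 i)%N.
Proof. by rewrite /stage; move: (\sum_(l < i) _) => S; lia. Qed.

Lemma stage_lt e : (e < \sum_(i < q) kappa i)%N ->
  exists i : 'I_q, (stage e i < stage e.+1 i)%N.
Proof.
move=> he; apply: contrapT => hn.
have : (\sum_(i < q) stage e.+1 i <= \sum_(i < q) stage e i)%N.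
  apply: leq_sum => i _; rewrite leqNgt; apply/negP => hi; apply: hn.
  by exists i.
by rewrite !sum_stage; lia.
Qed.

Definition stage_mx e (t : 'rV[R]_q) : 'M[R]_N :=
  vec_mx ((\row_i (w ^+ (r - stage e i) * t 0 i)) *m U).

Lemma stage_mx_lie e t : lie_centralizer JR y (stage_mx e t).
Proof.
apply/lie_centralizer_mxP; rewrite [_ *m U]mulmx_sum_row mulmx_suml big1 // => i _.
have hki : (stage e i <= kappa i)%N by rewrite /stage geq_minl.
have := U_lie i; rewrite -lie_centralizer_mxP => hi.
rewrite mxE -(subnK (leq_sub2l r hki)) exprD mulrAC -scalerA -scalemxAl hi.
by rewrite scaler0.
Qed.

Lemma stage_mx_widen e t : exists t', stage_mx e t = stage_mx e.+1 t'.
Proof.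
exists (\row_i (w ^+ (stage e.+1 i - stage e i) * t 0 i)); congr (vec_mx (_ *m _)).
apply/rowP => i; rewrite !mxE mulrA -exprD; congr (w ^+ _ * _).
have := stage_le e i; have : (stage e.+1 i <= r)%N.
  by apply: leq_trans (kappa_le i); apply: geq_minl.
by lia.
Qed.

Definition cayley_stage e X : Prop := exists t v,
  v * \det (1%:M + stage_mx e t) = 1 /\ X = v *: cayley_num (stage_mx e t).

Definition stage_closure e : set 'rV[F]_n :=
  zeros [set p | forall X, cayley_stage e X -> p.@[phi X 0] = 0].

Lemma stage_closureP e X : cayley_stage e X -> stage_closure e (phi X).
Proof. by move=> hX p; apply. Qed.

Lemma cayley_stage_one e : cayley_stage e (1 *: cayley_num (stage_mx e 0)).
Proof.
exists 0, 1; split=> //; rewrite mul1r /stage_mx.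
rewrite (_ : \row_i _ = 0); last by apply/rowP => i; rewrite !mxE mulr0.
by rewrite mul0mx linear0 addr0 det1.
Qed.

Lemma stage_mx_regular e :
  function_mx (regular rv (polynomial_function (@param q))) (stage_mx e).
Proof.
have ringR := regular_ring rv (polynomial_function_ring (@param q)).
move=> i j; have h : function_mx (regular rv (polynomial_function (@param q)))
    (fun t : 'rV[R]_q => \row_i (w ^+ (r - stage e i) * t 0 i)).
  move=> a b.
  apply: (fring_eq (fring_mul ringR (fring_cst ringR (w ^+ (r - stage e b)))
    (@param_entry q 0 b))) => t.
  by rewrite mxE.
have := fmx_mul ringR h (fmx_cst ringR U).
by move/(_ 0 (mxvec_index i j))/fring_eq; apply=> t; rewrite [RHS]mxE.
Qed.

(** A closure of a rational image of affine space. Two polynomials, each nonzero somewhere on the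
    image, become after raising to a power and clearing denominators nonzero polynomials in the
    parameters; their product cannot vanish wherever the transform is defined, that is, where [c] is
    nonzero. *)
Lemma stage_irreducible e : irreducible_set (stage_closure e).
Proof.
split; first by exists (phi (1 *: cayley_num (stage_mx e 0)));
  apply: stage_closureP; apply: cayley_stage_one.
move=> _ _ [S1 ->] [S2 ->] hZ; apply: contrapT => /not_orP[].
have pick S : ~ stage_closure e `<=` zeros S ->
    exists p X, [/\ S p, cayley_stage e X & p.@[phi X 0] <> 0].
  apply: contra_notP => hn v hv p Sp; apply: hv => X hX.
  by apply: contrapT => hp; apply: hn; exists p, X.
move=> /pick[p1 [_ [Sp1 [t1 [v1 [hv1 ->]]] hp1]]] /pick[p2 [_ [Sp2 [t2 [v2 [hv2 ->]]] hp2]]].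
have [k hk] := cayley_power phi_entry.
pose P := polynomial_function (@param q).
have ringP : function_ring P by exact: polynomial_function_ring.
have ringR := regular_ring rv ringP.
have PM := stage_mx_regular e.
pose fp (p : {mpoly F[n]}) (X : 'M[R]_N) := p.@[phi X 0].
have [|e1 [q1 [Pq1 hq1]]] := hk _ P (stage_mx e) 1%:M (fp p1) ringP PM; first by exists p1.
have [|e2 [q2 [Pq2 hq2]]] := hk _ P (stage_mx e) 1%:M (fp p2) ringP PM; first by exists p2.
pose c t := res (\det (1%:M + stage_mx e t)).
have Pc : P c.
  apply: (regular_res ringP); apply: (fring_det ringR); apply: (fmx_add ringR) => //.
  exact: fmx_cst.
have c_neq0 t v : v * \det (1%:M + stage_mx e t) = 1 -> c t != 0.
  move=> hv; apply/eqP => h0; have := congr1 res hv; rewrite rmorphM /= -/(c t) h0.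
  by rewrite mulr0 rmorph1 => /eqP; rewrite eq_sym oner_eq0.
have q_neq0 (p : {mpoly F[n]}) qq ee t v : (forall t v, v * \det (1%:M + stage_mx e t) = 1 ->
      fp p (1%:M *m (v *: cayley_num (stage_mx e t))) ^+ k.+1 *
      res (\det (1%:M + stage_mx e t)) ^+ ee = qq t) ->
    v * \det (1%:M + stage_mx e t) = 1 ->
    p.@[phi (v *: cayley_num (stage_mx e t)) 0] <> 0 -> qq t <> 0.
  move=> hqq hv hp; rewrite -(hqq t v hv) mul1mx; apply/eqP.
  by rewrite mulf_neq0 ?expf_neq0 ?(c_neq0 t v) //; apply/eqP.
have [|h0|h0] := polynomial_function_mul (fring_mul ringP Pq1 Pq2) Pc.
- move=> t; have [->|ct] := eqVneq (c t) 0; first by rewrite mulr0.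
  have [v hv] := rv_unitP ct; rewrite mulrC in hv.
  rewrite -(hq1 t v hv) -(hq2 t v hv) !mul1mx.
  have hin : cayley_stage e (v *: cayley_num (stage_mx e t)) by exists t, v.
  have [/(_ _ Sp1) hz|/(_ _ Sp2) hz] := hZ _ (stage_closureP hin);
    by rewrite /fp hz expr0n /= !(mul0r, mulr0).
- have [h1|h2] := polynomial_function_mul Pq1 Pq2 h0.
    exact: q_neq0 hq1 hv1 hp1 (h1 _).
  exact: q_neq0 hq2 hv2 hp2 (h2 _).
- by have := c_neq0 _ _ hv1; rewrite h0 eqxx.
Qed.

Lemma stage_closure_regular e (psi : 'M[R]_N -> R) a X :
  regular rv (polynomial_function phi) psi ->
  (forall X', cayley_stage e X' -> psi X' = a) ->
  stage_closure e (phi X) -> psi X = a.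
Proof.
move=> hpsi ha hX; apply: (bij_inj (rv_bij rv)); apply/rowP => l.
have [p hp] := hpsi l; apply/eqP; rewrite -subr_eq0; apply/eqP.
have := hX (p - (rv a 0 l)%:MP); rewrite mevalB mevalC -hp; apply=> X' hX'.
by rewrite mevalB mevalC -hp (ha _ hX') subrr.
Qed.

Lemma stage_closure_sub e : stage_closure e `<=` phi @` C.
Proof.
move=> v hv; have [X hX] := phi_surj v; exists X => //.
have ringphi : function_ring (polynomial_function phi) by exact: polynomial_function_ring.
have ringR := regular_ring rv ringphi; have id_reg := phi_entry_regular.
have cay X' : cayley_stage e X' -> C X'.
  by move=> [t [v' [hv' ->]]]; apply: (cayley_centralizer JiJ hv'); apply: stage_mx_lie.
rewrite -hX in hv; split; first split.
- apply/matrixP => i j.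
  apply: (stage_closure_regular (psi := fun X => (X^T *m JR *m X) i j) _ _ hv).
    apply: (fmx_mul ringR) => //; apply: (fmx_mul ringR); last exact: fmx_cst.
    exact: (fmx_tr id_reg).
  by move=> X' /cay[[-> _] _].
- apply: (stage_closure_regular (psi := fun X => \det X) _ _ hv).
    exact: (fring_det ringR).
  by move=> X' /cay[[_ ->] _].
- apply/eqP; rewrite -subr_eq0; apply/eqP/matrixP => i j; rewrite [RHS]mxE.
  apply: (stage_closure_regular (psi := fun X => (X *m y - y *m X) i j) _ _ hv).
    apply: (fmx_add ringR); first by apply: (fmx_mul ringR) => //; exact: fmx_cst.
    apply: (fmx_opp ringR); apply: (fmx_mul ringR) => //; exact: fmx_cst.
  by move=> X' /cay[_ ->]; rewrite subrr mxE.
Qed.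

Lemma cayley_stage_mono e X : cayley_stage e X -> cayley_stage e.+1 X.
Proof.
move=> [t [v [hv ->]]]; have [t' ht'] := stage_mx_widen e t.
by exists t', v; rewrite -ht'.
Qed.

(** Some coordinate i has a larger stage at [e.+1]. Recovering that coordinate by the inverse Cayley
    transform and multiplying by [w ^+ stage e i] gives a regular function that vanishes on the
    closure at stage [e], but not on all of the next one. *)
Lemma stage_closure_lt e : (e < \sum_(i < q) kappa i)%N ->
  stage_closure e `<` stage_closure e.+1.
Proof.
move=> he; split.
  by move=> v hv p hp; apply: hv => X /cayley_stage_mono; apply: hp.
have [i hi] := stage_lt he.
pose Y := stage_mx e.+1 (delta_mx 0 i).
(* A nonroot of [p] is the residue of a scalar tau that is a unit, thanks to the factor 'X, and for
   which 1 + tau Y is invertible. *)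
pose p : {poly F} := 'X * \det (1%:M + 'X *: map_mx (polyC \o res) Y).
have pE s : p.[s] = s * \det (1%:M + s *: map_mx res Y).
  rewrite hornerM hornerX -[X in _ * X]/(horner_eval s _) -det_map_mx; congr (_ * \det _).
  rewrite map_mxD map_mx1 map_mxZ; congr (_ + _); rewrite /= /horner_eval hornerX.
  by congr (_ *: _); apply/matrixP => a b; rewrite !mxE hornerC.
have p0 : p != 0.
  rewrite mulf_neq0 ?polyX_eq0 //; apply/eqP => h0.
  have := congr1 (horner_eval 0) h0; rewrite -det_map_mx map_mxD map_mx1 map_mxZ.
  rewrite /= /horner_eval hornerX horner0 scale0r addr0 det1 => /eqP.
  by rewrite oner_eq0.
have /closed_nonrootP[s hs] := p0.
have [tau htau] := rv_res_surj rv s.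
have hs0 : res tau * res (\det (1%:M + tau *: Y)) != 0.
  by rewrite -det_map_mx map_mxD map_mx1 map_mxZ /= htau -pE.
have [tau' htau'] : exists tau', tau' * tau = 1.
  have [|u hu] := @rv_unitP _ _ _ rv tau; last by exists u; rewrite mulrC.
  by move: hs0; rewrite mulf_eq0 negb_or => /andP[].
have [v hv] : exists v, v * \det (1%:M + tau *: Y) = 1.
  have [|u hu] := @rv_unitP _ _ _ rv (\det (1%:M + tau *: Y)); last by exists u; rewrite mulrC.
  by move: hs0; rewrite mulf_eq0 negb_or => /andP[].
have hYt : tau *: Y = stage_mx e.+1 (tau *: delta_mx 0 i).
  rewrite /Y /stage_mx; set u := \row_l _; set u' := \row_l _.
  have -> : u' = tau *: u by apply/rowP => l; rewrite !mxE mulrCA.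
  by rewrite -scalemxAl linearZ.
rewrite hYt in hv; set X := stage_mx e.+1 (tau *: delta_mx 0 i) in hv.
move=> /(_ (phi (v *: cayley_num X))) hsub.
have hX1 : cayley_stage e.+1 (v *: cayley_num X) by exists (tau *: delta_mx 0 i), v.
have ringphi : function_ring (polynomial_function phi) by exact: polynomial_function_ring.
have ringR := regular_ring rv ringphi.
(* On a transform, [cayley_num] returns a unit times the original matrix, from which [U'] extracts
   the coordinates along the rows of [U]. *)
pose psi g := (mxvec (cayley_num g) *m U') 0 i * w ^+ stage e i.
have psi_cay e' t v' : v' * \det (1%:M + stage_mx e' t) = 1 ->
    psi (v' *: cayley_num (stage_mx e' t)) =
    \det (1%:M + v' *: cayley_num (stage_mx e' t)) *
      (w ^+ (r - stage e' i) * t 0 i) * w ^+ stage e i.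
  move=> hv'; rewrite /psi cayley_num_cayley // linearZ /= -scalemxAl mxE.
  have -> : mxvec (stage_mx e' t) = (\row_l (w ^+ (r - stage e' l) * t 0 l)) *m U.
    by rewrite /stage_mx vec_mxK.
  by rewrite -mulmxA UU' mulmx1 [X in _ * X * _]mxE.
have hr : w ^+ r = 0 by exact: rv_unif_nilpotent.
have : psi (v *: cayley_num X) = 0.
  apply: (@stage_closure_regular e); last exact: hsub (stage_closureP hX1).
    apply: (fring_mul ringR); last exact: fring_cst.
    apply: (fmx_mul ringR); last exact: fmx_cst.
    move=> a b; have := cayley_num_regular ringphi phi_entry_regular.
    by case/mxvec_indexP: b => b b'; move/(_ b b')/fring_eq; apply=> t; rewrite [a]ord1 mxvecE.
  move=> _ [t [v' [hv' ->]]]; rewrite psi_cay //.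
  have hle : (stage e i <= r)%N by rewrite (leq_trans (geq_minl _ _)).
  rewrite -!mulrA [t 0 i * _]mulrC [w ^+ (r - _) * _]mulrA -exprD subnK // hr.
  by rewrite mul0r mulr0.
have [w' hw'] := cayley_det half2 hv.
rewrite psi_cay // !mxE !eqxx mulr1 => h0.
apply: (@rv_unif_neq0 _ _ _ rv); rewrite -/w.
set D := \det _ in h0 hw'; set a := stage e.+1 i in h0 hi; set b := stage e i in h0 hi.
have har : (a <= r)%N by rewrite (leq_trans (geq_minl _ _)).
(* As b < a, the vanishing of [psi] would kill, up to units, [w ^+ (r - a + b)] and hence its
   multiple [w ^+ r.-1]. *)
have -> : r.-1 = (r - a + b + (a - b).-1)%N by move: har hi; clear; lia.
rewrite 2!exprD -[X in X * _]mul1r -hw' -[X in X * _]mul1r -htau'.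
transitivity (tau' * w' * w ^+ (a - b).-1 * (D * (w ^+ (r - a) * tau) * w ^+ b)).
  by ring.
by rewrite h0 mulr0.
Qed.

Lemma centralizer_dim_ge : dim_ge (phi @` C) (\sum_(i < q) kappa i).
Proof.
exists stage_closure; split=> [e _|e]; last exact: stage_closure_lt.
split; [by eexists|exact: stage_irreducible|exact: stage_closure_sub].
Qed.
End LowerBound.
End CentralizerDimension.

(** * Saturated kernels over a discrete valuation ring *)

Local Open Scope quotient_scope.

Lemma fraction_numden (A : idomainType) (x : {fraction A}) :
  exists n d, d != 0 /\ tofrac d * x = tofrac n.
Proof.
elim/quotW: x => x; exists x.1, x.2; split; first exact: denom_ratioP.
unlock tofrac; rewrite -[LHS]FracField.pi_mul; apply/eqmodP => /=.
rewrite FracField.equivfE /FracField.mulf !numden_Ratio ?mulf_neq0 ?oner_neq0 ?denom_ratioP //.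
by rewrite mulr1 mul1r mulrC.
Qed.
Local Close Scope quotient_scope.

Lemma finite_minimum (I : finType) (le : I -> I -> Prop) (i0 : I) :
  (forall i j, le i j \/ le j i) -> (forall i j l, le i j -> le j l -> le i l) ->
  exists i, forall j, le i j.
Proof.
move=> total trans.
suff H (s : seq I) : exists i, forall j, j \in s -> le i j.
  by have [i hi] := H (enum I); exists i => j; apply: hi; rewrite mem_enum.
elim: s => [|j s [i hi]]; first by exists i0.
have [hij|hji] := total i j.
  by exists i => l; rewrite in_cons => /orP[/eqP ->|/hi].
exists j => l; rewrite in_cons => /orP[/eqP ->|/hi hil]; last exact: trans hil.
by case: (total j j).
Qed.

Lemma kermx_rows (F : fieldType) n p q (L : 'M[F]_(p, q)) :
  (\rank L + n <= p)%N -> exists U : 'M[F]_(n, p), row_free U /\ U *m L = 0.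
Proof.
move=> hn; exists (pid_mx n *m row_base (kermx L)); split.
  rewrite /row_free mxrankMfree ?row_base_free // rank_pid_mx //.
  by rewrite mxrank_ker; lia.
apply/sub_kermxP; apply: submx_trans (submxMl _ _) _.
by rewrite eq_row_base.
Qed.

Section SaturatedKernel.
Variables (o : idomainType) (pi : o).
Hypothesis dvr : forall a, a != 0 ->
  exists n, exists2 u, u \is a GRing.unit & a = u * pi ^+ n.
Let K := {fraction o}.

(** The order by valuation, without introducing the valuation itself. *)
Definition divides (a b : K) : Prop := exists c : o, b = tofrac c * a.

Lemma divides_total a b : divides a b \/ divides b a.
Proof.
have total_o (x y : o) : (exists c, y = c * x) \/ exists c, x = c * y.
  have [->|x0] := eqVneq x 0; first by right; exists 0; rewrite mul0r.
  have [->|y0] := eqVneq y 0; first by left; exists 0; rewrite mul0r.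
  have [m [u hu ->]] := dvr x0; have [n [v hv ->]] := dvr y0.
  have [hmn|hmn] := leqP m n; [left|right].
    exists (v / u * pi ^+ (n - m)); by rewrite mulrACA divrK // -exprD subnK.
  exists (u / v * pi ^+ (m - n)); by rewrite mulrACA divrK // -exprD subnK ?(ltnW hmn).
have [m [d [d0 hd]]] := fraction_numden a; have [n [e [e0 he]]] := fraction_numden b.
have f0 : tofrac (d * e) != 0 by rewrite tofrac_eq0 mulf_neq0.
have ha : tofrac (d * e) * a = tofrac (m * e) by rewrite !tofracM mulrAC hd.
have hb : tofrac (d * e) * b = tofrac (n * d) by rewrite !tofracM -mulrA he mulrC.
have [[c hc]|[c hc]] := total_o (m * e) (n * d); [left|right]; exists c;
  by apply: (mulfI f0); rewrite mulrCA ha hb hc tofracM.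
Qed.

Lemma divides_trans a b c : divides a b -> divides b c -> divides a c.
Proof. by move=> [x ->] [y ->]; exists (y * x); rewrite tofracM mulrA. Qed.

(* The rows of a maximal minor of least valuation generate a saturated kernel:  *)
(* by Cramer's rule the normalized rows are integral.                           *)
Lemma saturated_kernel p q n (L : 'M[o]_(p, q)) :
  (\rank (map_mx (@tofrac o) L) + n <= p)%N ->
  exists (U : 'M[o]_(n, p)) (E : 'M[o]_(p, n)), U *m L = 0 /\ U *m E = 1%:M.
Proof.
set LK := map_mx _ L => hn.
have [B [Bfree BL]] := kermx_rows hn.
have Bfull : row_full B^T by rewrite /row_full mxrank_tr.
pose minor (g : {ffun 'I_n -> 'I_p}) := \det (colsub g B).
have [g0 hg0] : exists g, minor g != 0.
  exists [ffun i => fullrankfun Bfull i]; rewrite /minor -det_tr -unitfE -unitmxE.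
  rewrite (_ : _^T = rowsub (fullrankfun Bfull) B^T) ?fullrowsub_unit //.
  by apply/matrixP => i j; rewrite !mxE ffunE.
have [g hg] := finite_minimum g0 (fun i j => divides_total (minor i) (minor j))
  (fun i j l => @divides_trans _ _ _).
have mg : minor g != 0.
  by apply: contraNneq hg0 => h0; have [c ->] := hg g0; rewrite h0 mulr0.
have ug : colsub g B \in unitmx by rewrite unitmxE unitfE.
pose UK := invmx (colsub g B) *m B.
have integral i j : exists c : o, tofrac c = UK i j.
  have [c hc] := hg [ffun l => if l == i then j else g l].
  (* Cramer's rule: entry (i, j) is the minor with its i-th chosen column replaced by column j,
     divided by [minor g], which divides every minor. *)
  exists c; apply: (mulIf mg); rewrite -hc /UK /minor mxE /invmx ug mulr_suml.
  rewrite (expand_det_col _ i); apply: eq_bigr => l _.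
  rewrite [colsub _ _ _ _]mxE ffunE eqxx [X in _ = X * _ * _]mxE [\adj _ _ _]mxE.
  have -> : cofactor (colsub [ffun l => if l == i then j else g l] B) l i =
      cofactor (colsub g B) l i.
    congr (_ * \det _); apply/matrixP => a b; rewrite !mxE ffunE.
    by rewrite eq_sym (negPf (neq_lift _ _)).
  rewrite -/(minor g); move: (cofactor _ _ _) (B l j) (minor g) mg => x z m m0.
  by field.
have [u hu] := choice (fun ij => integral ij.1 ij.2).
pose U : 'M[o]_(n, p) := \matrix_(i, j) u (i, j).
have UE : map_mx (@tofrac o) U = UK by apply/matrixP => i j; rewrite 2!mxE hu.
have inj m1 m2 (A A' : 'M[o]_(m1, m2)) :
    map_mx (@tofrac o) A = map_mx (@tofrac o) A' -> A = A'.
  move=> h; apply/matrixP => i j; apply/eqP; rewrite -tofrac_eq; apply/eqP.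
  by have := congr1 (fun M : 'M_(m1, m2) => M i j) h; rewrite !mxE.
exists U, (\matrix_(a, i) (a == g i)%:R); split; apply: inj.
  by rewrite map_mxM UE /UK -mulmxA BL mulmx0 map_mx0.
rewrite map_mxM UE map_mx1 -(mulVmx ug) /UK -mulmxA; congr (_ *m _).
apply/matrixP => i j; rewrite !mxE (bigD1 (g j)) //= big1 ?addr0.
  by rewrite !mxE eqxx rmorph1 mulr1.
by move=> l hl; rewrite !mxE (negPf hl) rmorph0 mulr0.
Qed.
End SaturatedKernel.

(** * Lifting and the two ring varieties *)

Section Lifting.
Variables (R : comPzRingType) (F : closedFieldType) (r : nat).
Variable rv : ring_variety R F r.
Let res : {rmorphism R -> F} := rv_res rv.

Lemma rv_mx_surj m n (A : 'M[F]_(m, n)) : exists B : 'M[R]_(m, n), map_mx res B = A.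
Proof.
have [sec hsec] := choice (rv_res_surj rv).
by exists (map_mx sec A); apply/matrixP => i j; rewrite !mxE hsec.
Qed.

Lemma rv_mx_inverse n (A : 'M[R]_n) :
  map_mx res A \in unitmx -> exists B, A *m B = 1%:M /\ B *m A = 1%:M.
Proof.
rewrite unitmxE unitfE det_map_mx => /rv_unitP[v]; rewrite mulrC => hv.
by exists (v *: \adj A); apply: scaled_adjK.
Qed.

Lemma rv_right_inverse m n (A : 'M[R]_(m, n)) :
  row_free (map_mx res A) -> exists B, A *m B = 1%:M.
Proof.
case/row_freeP=> B hB; have [B' hB'] := rv_mx_surj B.
have [|C [hC _]] := @rv_mx_inverse _ (A *m B').
  by rewrite map_mxM hB' hB unitmx1.
by exists (B' *m C); rewrite mulmxA.
Qed.

Variables (o : comPzRingType) (f : o -> R) (N : nat) (J : 'M[o]_N).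
Let JR := map_mx f J.
Variables (Ji : 'M[R]_N) (half : R).
Hypotheses (JiJ : Ji *m JR = 1%:M) (half2 : half *+ 2 = 1).
Hypothesis JT : JR^T = - JR \/ JR^T = JR.

(** Half of Y - J^-1 Y^T J projects any lift Y into the Lie algebra, since Y -> J^-1 Y^T J is an
    involution when J^T = J or J^T = - J. The reduction [c] is fixed by this projection. *)
Lemma lie_lift c : c^T *m map_mx res JR + map_mx res JR *m c = 0 ->
  exists y, map_mx res y = c /\ y^T *m JR + JR *m y = 0.
Proof.
move=> hc; have [Y hY] := rv_mx_surj c.
have JJi : JR *m Ji = 1%:M by apply: mulmx1C.
exists (half *: (Y - Ji *m Y^T *m JR)); split.
  have hYT : map_mx res Y^T = c^T by rewrite -map_trmx hY.
  have hres2 : res half * 2%:R = 1 by rewrite mulr_natr -rmorphMn half2 rmorph1.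
  have hcJ : c^T *m map_mx res JR = - (map_mx res JR *m c).
    by apply/eqP; rewrite -addr_eq0 hc.
  rewrite map_mxZ map_mxB !map_mxM hYT hY -mulmxA hcJ mulmxN mulmxA -map_mxM JiJ.
  by rewrite map_mx1 mul1mx opprK -mulr2n -scaler_nat scalerA hres2 scale1r.
have hJi : Ji^T *m JR^T = 1%:M by rewrite -trmx_mul JJi trmx1.
rewrite linearZ linearB /= !trmx_mul trmxK -scalemxAl -scalemxAr -scalerDr.
rewrite mulmxBl mulmxBr !mulmxA JJi mul1mx.
have -> : JR^T *m Y *m Ji^T *m JR = JR *m Y.
  case: JT => hJ; rewrite hJ in hJi *; last by rewrite -mulmxA hJi mulmx1.
  rewrite !mulNmx -!mulmxA [Ji^T *m JR](_ : _ = - 1%:M) ?mulmxN ?mulmx1 ?opprK //.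
  by rewrite -hJi mulmxN opprK.
by rewrite addrA subrK subrr scaler0.
Qed.

Variables (n : nat) (phi : 'M[R]_N -> 'rV[F]_n).
Hypothesis phi_entry : forall l, exists i j l', forall X, phi X 0 l = rv (X i j) 0 l'.
Hypothesis entry_phi : forall i j l', exists l, forall X, phi X 0 l = rv (X i j) 0 l'.

(** A lift of a cyclic element of the residue Lie algebra remains cyclic, its Krylov determinant
    being a unit. Its Lie centralizer is thus spanned by [N./2] odd powers, each contributing at
    most [r] dimensions. *)
Lemma exists_small_centralizer : exists y, cl_lie f J y /\
  forall d, dim_ge (phi @` cl_centralizer f J y) d -> (d <= N./2 * r)%N.
Proof.
have two : (2%:R : F) != 0.
  apply/eqP => h; have := congr1 res half2; rewrite rmorphMn /= -mulr_natr h mulr0.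
  by rewrite rmorph1 => /eqP; rewrite eq_sym oner_eq0.
have uJ : map_mx res JR \in unitmx.
  have /mulmx1_unit[] // : map_mx res Ji *m map_mx res JR = 1%:M.
  by rewrite -map_mxM JiJ map_mx1.
have hJT : (map_mx res JR)^T = - map_mx res JR \/ (map_mx res JR)^T = map_mx res JR.
  by rewrite map_trmx; case: JT => ->; [left; rewrite map_mxN|right].
have [c hc [v hv]] := cyclic_lie_exists two uJ hJT.
have [y [hy hyJ]] := lie_lift hc; have [v' hv'] := rv_mx_surj v.
exists y; split=> // d; apply: (centralizer_dim_le half2 phi_entry entry_phi).
have [|K [hK _]] := @rv_mx_inverse _ (krylov v' y).
  by rewrite map_krylov hv' hy.
move=> X; exact: (cyclic_lie_centralizer JiJ half2 hK hyJ).
Qed.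
End Lifting.

Definition field_coord (F : closedFieldType) (a : F) : 'rV[F]_1 := const_mx a.

Lemma field_coordE (F : closedFieldType) (a : F) l : field_coord a 0 l = a.
Proof. by rewrite mxE. Qed.

Definition field_variety (F : closedFieldType) : ring_variety F F 1.
Proof.
apply: (@RingVariety _ _ _ (@field_coord F) _ _ _ idfun _ _ 0).
- exists (fun u : 'rV[F]_1 => u 0 0) => [a|u]; first by rewrite mxE.
  by apply/rowP => l; rewrite mxE !ord1.
- exists (fun _ => 'X_(lshift 1 0) + 'X_(rshift 1 0)) => u v l.
  by rewrite mevalD !mevalXU (row_mxEl _ _ 0 0) (row_mxEr _ _ 0 0) !field_coordE.
- exists (fun _ => 'X_(lshift 1 0) * 'X_(rshift 1 0)) => u v l.
  by rewrite mevalM !mevalXU (row_mxEl _ _ 0 0) (row_mxEr _ _ 0 0) !field_coordE.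
- by exists 'X_0 => a; rewrite mevalXU field_coordE.
- by move=> c; exists c.
- by move=> a ha; exists 0; rewrite mul0r.
- move=> [|[|j]] a // _; split.
  + by rewrite expr0 mul1r => ->; exists 0; rewrite mulr0.
  + by case=> b ->; rewrite subn0 expr1 mul0r mulr0.
  + by exists a; rewrite subnn expr0 mul1r.
  + by rewrite expr1 mul0r.
- by rewrite expr0; apply/eqP; rewrite oner_eq0.
Defined.

Section PowQuotVariety.
Variables (O : idomainType) (pi : O) (F : closedFieldType).
Variables (res : {rmorphism O -> F}) (m : nat) (gr : greenberg_structure pi res m).
Hypotheses (m_gt0 : (0 < m)%N) (pi_neq0 : pi != 0) (hres : is_residue_map pi res).

Lemma residue_uniformizer : res pi = 0.
Proof. by apply/hres.2/asboolP; exists 1; rewrite expr1 mulr1. Qed.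

Definition pow_quot_res (u : pow_quot pi m) : F := res (pow_rep u).

Lemma pow_quot_res_red a : pow_quot_res (pow_red pi m a) = res a.
Proof.
apply/eqP; rewrite -subr_eq0 -rmorphB; apply/eqP.
have /asboolP[b ->] : pow_rep (pow_red pi m a) - a \in pow_ideal pi m.
  by apply/pow_redP; rewrite pow_repK.
by rewrite rmorphM rmorphXn /= residue_uniformizer expr0n; case: m m_gt0 => // ? _;
  rewrite mul0r.
Qed.

Fact pow_quot_res_zmod_morphism : zmod_morphism pow_quot_res.
Proof.
move=> u v; rewrite -[u]pow_repK -[v]pow_repK -rmorphB !pow_quot_res_red.
exact: rmorphB.
Qed.

Fact pow_quot_res_monoid_morphism : monoid_morphism pow_quot_res.
Proof.
split=> [|u v]; first by rewrite -(rmorph1 (pow_red pi m)) pow_quot_res_red rmorph1.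
by rewrite -[u]pow_repK -[v]pow_repK -rmorphM !pow_quot_res_red rmorphM.
Qed.

Lemma pow_red_eq0 a : pow_red pi m a = 0 <-> exists b, a = pi ^+ m * b.
Proof.
rewrite -[0](raddf0 (pow_red pi m)) pow_redP subr0.
by split=> [/asboolP|?]; [|apply/asboolP].
Qed.

Definition pow_quot_res_morphism : {rmorphism pow_quot pi m -> F} :=
  HB.pack pow_quot_res
    (GRing.isZmodMorphism.Build _ _ pow_quot_res pow_quot_res_zmod_morphism)
    (GRing.isMonoidMorphism.Build _ _ pow_quot_res pow_quot_res_monoid_morphism).

Definition pow_quot_variety : ring_variety (pow_quot pi m) F m.
Proof.
apply: (@RingVariety _ _ _ gr (gr_bij gr) (gr_add gr) (gr_mul gr)
  pow_quot_res_morphism _ _ (pow_red pi m pi)).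
- have [P hP] := gr_res gr; exists P => u.
  by rewrite -[u]pow_repK /= pow_quot_res_red hP.
- by move=> c; have [a <-] := hres.1 c; exists (pow_red pi m a); rewrite /= pow_quot_res_red.
- move=> u; rewrite -[u]pow_repK /= pow_quot_res_red => /hres.2/asboolP[b ->].
  by exists (pow_red pi m b); rewrite expr1 rmorphM.
- move=> j u hj; rewrite -[u]pow_repK -rmorphXn -rmorphM pow_red_eq0 /=.
  have hmj : pi ^+ m = pi ^+ j * pi ^+ (m - j) by rewrite -exprD subnKC.
  split=> [[b]|[b hb]].
    rewrite hmj -mulrA => /(mulfI (expf_neq0 _ pi_neq0)) ->.
    by exists (pow_red pi m b); rewrite -rmorphXn -rmorphM.
  have : pow_red pi m (pow_rep u - pi ^+ (m - j) * pow_rep b) = 0.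
    by rewrite rmorphB rmorphM rmorphXn /= hb pow_repK subrr.
  case/pow_red_eq0 => d /eqP; rewrite subr_eq => /eqP ->.
  exists (pi ^+ j * d + pow_rep b); rewrite hmj; ring.
- rewrite -rmorphXn => /pow_red_eq0[b].
  rewrite -{2}(prednK m_gt0) exprSr -mulrA -[LHS]mulr1.
  move/(mulfI (expf_neq0 _ pi_neq0))/(congr1 res).
  by rewrite rmorph1 rmorphM residue_uniformizer mul0r => /eqP; rewrite oner_eq0.
Defined.
End PowQuotVariety.

(** * The main theorem *)

Section CompleteDVR.
Variables (o : idomainType) (pi : o).
Hypothesis hdvr : complete_dvr pi.

Lemma pow_idealW m n a : (m <= n)%N -> a \in pow_ideal pi n -> a \in pow_ideal pi m.
Proof.
move=> hmn /asboolP[b ->]; apply/asboolP; exists (pi ^+ (n - m) * b).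
by rewrite mulrA -exprD subnKC.
Qed.

Lemma dvr_separated a : (forall m, a \in pow_ideal pi m) -> a = 0.
Proof.
case: hdvr => pi0 piN dvr _ ha; apply/eqP; apply: contraT => a0.
have [n [u hu hun]] := dvr a a0; have /asboolP[b] := ha n.+1.
rewrite hun mulrC exprSr -mulrA => /(mulfI (expf_neq0 _ pi0)) hub.
by move: hu; rewrite hub unitrM (negPf piN).
Qed.

Lemma pow_red_inj a b : (forall m, pow_red pi m.+1 a = pow_red pi m.+1 b) -> a = b.
Proof.
move=> h; apply/eqP; rewrite -subr_eq0; apply/eqP/dvr_separated => m.
by apply: (@pow_idealW m m.+1) => //; apply/pow_redP.
Qed.

Lemma map_pow_red_inj m n (A B : 'M[o]_(m, n)) :
  (forall l, map_mx (pow_red pi l.+1) A = map_mx (pow_red pi l.+1) B) -> A = B.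
Proof.
move=> h; apply/matrixP => i j; apply: pow_red_inj => l.
by have := congr1 (fun M : 'M_(m, n) => M i j) (h l); rewrite !mxE.
Qed.

Lemma pow_quot_map_id m a :
  @pow_quot_map o o idfun pi pi m.+2 m.+1 (pow_red pi m.+2 a) = pow_red pi m.+1 a.
Proof.
apply/pow_redP; apply: (@pow_idealW _ m.+2) => //; apply/pow_redP.
by rewrite pow_repK.
Qed.

Lemma centralizer_limit_bij N (J x : 'M[o]_N) :
  set_bij (cl_centralizer idfun J x) (centralizer_limit pi J x)
    (fun g m => map_mx (pow_red pi m.+1) g).
Proof.
have Jid : map_mx idfun J = J by apply/matrixP => i j; rewrite mxE.
have red m g : cl_centralizer idfun J x g -> cl_centralizer (pow_red pi m.+1) J
    (map_mx (pow_red pi m.+1) x) (map_mx (pow_red pi m.+1) g).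
  move=> [[hJ hd] hx]; rewrite Jid in hJ; split; first split.
  - by rewrite map_trmx -!map_mxM hJ.
  - by rewrite det_map_mx hd rmorph1.
  - by rewrite -!map_mxM hx.
split.
- move=> g hg m; split; first exact: red.
  by apply/matrixP => i j; rewrite !mxE pow_quot_map_id.
- move=> g g' _ _ h; apply: map_pow_red_inj => l.
  exact: (congr1 (fun u : forall m, 'M[pow_quot pi m.+1]_N => u l) h).
move=> h hh; have [pi0 piN dvr compl] := hdvr.
pose s (ij : 'I_N * 'I_N) n := pow_rep (h n ij.1 ij.2).
have hs ij n : s ij n.+1 - s ij n \in pow_ideal pi n.+1.
  apply/pow_redP; rewrite [RHS]pow_repK -[in RHS](hh n).2 mxE.
  by [].
have [g0 hg0] := choice (fun ij => compl (s ij) (fun n => pow_idealW (leqnSn n) (hs ij n))).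
pose g : 'M[o]_N := \matrix_(i, j) g0 (i, j).
have hg m : map_mx (pow_red pi m.+1) g = h m.
  apply/matrixP => i j; rewrite !mxE -[RHS]pow_repK; apply/pow_redP.
  (* The limit is compared with the term at [m.+1], because completeness places its difference from
     the term at [m] only in the m-th power ideal, one short of what is needed. *)
  have -> : g0 (i, j) - pow_rep (h m i j) =
      (g0 (i, j) - s (i, j) m.+1) + (s (i, j) m.+1 - s (i, j) m).
    by rewrite addrA subrK.
  by rewrite rpredD ?hs ?hg0.
have hC m := (hh m).1.
exists g; last by apply: functional_extensionality_dep => m; exact: hg.
split; first split; rewrite ?Jid.
- apply: map_pow_red_inj => m; have [[hJ _] _] := hC m.
  by rewrite !map_mxM -map_trmx hg hJ.
- apply: pow_red_inj => m; have [[_ hd] _] := hC m.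
  by rewrite -det_map_mx hg hd rmorph1.
- by apply: map_pow_red_inj => m; have [_ hx] := hC m; rewrite !map_mxM hg hx.
Qed.
End CompleteDVR.

(** * From regularity modulo a power of pi to regularity over [Kalg] *)

Section Regularity.
Variables (o : idomainType) (pi : o) (k : finFieldType) (res : {rmorphism o -> k}).
Variables (Kalg : closedFieldType) (iota : {rmorphism {fraction o} -> Kalg}).
Variables (O : idomainType) (i : {rmorphism o -> O}).
Variables (kalg : closedFieldType) (resO : {rmorphism O -> kalg}).
Variables (N : nat) (J x : 'M[o]_N) (r : nat).
Variable gr : greenberg_structure (i pi) resO r.
Hypothesis hdvr : complete_dvr pi.
Hypothesis hres : is_residue_map pi res.
Hypothesis odd_char : forall p, p \in [pchar k] -> odd p.
Hypothesis i_inj : injective i.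
Hypothesis hresO : is_residue_map (i pi) resO.
Hypothesis uJ : J \in unitmx.
Hypothesis JT : J^T = - J \/ J^T = J.
Hypothesis x_lie : x^T *m J + J *m x = 0.
Hypothesis r_gt0 : (1 <= r)%N.
Hypothesis x_reg : cl_regular_mod gr J (map_mx (pow_red pi r) x).

Lemma exists_half : exists half : o, half *+ 2 = 1.
Proof.
have [pi0 piN dvr _] := hdvr.
have two : res 2%:R != 0.
  rewrite rmorph_nat; apply/negP => h2.
  by have := odd_char (p := 2); rewrite inE /= h2 => /(_ isT).
have two0 : (2%:R : o) != 0 by apply: contraNneq two => ->; rewrite rmorph0.
have [[|n] [u hu h2]] := dvr _ two0.
  rewrite expr0 mulr1 in h2; exists u^-1.
  by rewrite -mulr_natr h2 mulVr.
move: two; rewrite h2 exprS mulrCA rmorphM.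
have -> : res pi = 0 by apply/hres.2/asboolP; exists 1; rewrite expr1 mulr1.
by rewrite mul0r eqxx.
Qed.

Let n := N./2.
Let L := lie_centralizer_mx J x.
Let j : {rmorphism o -> Kalg} := iota \o @tofrac o.
Let rho : {rmorphism o -> kalg} := resO \o i.
Let red : {rmorphism o -> pow_quot (i pi) r} := pow_red (i pi) r \o i.

Lemma unit_fields (F : fieldType) (g : {rmorphism o -> F}) :
  [/\ (2%:R : F) != 0, map_mx g J \in unitmx
    & (map_mx g J)^T = - map_mx g J \/ (map_mx g J)^T = map_mx g J].
Proof.
have [half hh] := exists_half; split.
- apply/eqP => h; have := congr1 g hh; rewrite rmorphMn /= -mulr_natr h mulr0.
  by rewrite rmorph1 => /eqP; rewrite eq_sym oner_eq0.
- have /mulmx1_unit[] // : map_mx g (invmx J) *m map_mx g J = 1%:M.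
  by rewrite -map_mxM mulVmx // map_mx1.
- by rewrite map_trmx; case: JT => ->; [left; rewrite map_mxN|right].
Qed.

Lemma rank_lie_centralizer_Kalg z : cl_lie j J z ->
  (\rank (lie_centralizer_mx (map_mx j J) z) + n <= N * N)%N.
Proof.
have [two uJ' JT'] := unit_fields j.
have [c hc [v hv]] := cyclic_lie_exists two uJ' JT'.
move=> hz; have hN : (N./2 <= N * N)%N.
  by case: (N) => // m; rewrite mulSn; have := odd_double_half m.+1; lia.
by rewrite -[leqRHS](subnK hN) leq_add2r; apply: rank_lie_centralizer hv hc hz.
Qed.

Lemma i_pi_neq0 : i pi != 0.
Proof. by have [pi0 _ _ _] := hdvr; rewrite -(rmorph0 i) (inj_eq i_inj). Qed.

Let rv := pow_quot_variety gr r_gt0 i_pi_neq0 hresO.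
Let rres : {rmorphism pow_quot (i pi) r -> kalg} := rv_res rv.

Lemma rres_red a : rres (red a) = rho a.
Proof. by rewrite /= pow_quot_res_red. Qed.

Lemma rres_red_mx a b (A : 'M[o]_(a, b)) : map_mx rres (map_mx red A) = map_mx rho A.
Proof. by apply/matrixP => u v; rewrite !mxE rres_red. Qed.

Lemma mx_coord_entry l : exists a b l',
  forall X : 'M[pow_quot (i pi) r]_N, mx_coord gr X 0 l = rv (X a b) 0 l'.
Proof.
case/mxvec_indexP: l => e l'; case/mxvec_indexP: e => a b.
by exists a, b, l' => X; rewrite mxvecE mxE mxvecE.
Qed.

Lemma entry_mx_coord a b l' : exists l,
  forall X : 'M[pow_quot (i pi) r]_N, mx_coord gr X 0 l = rv (X a b) 0 l'.
Proof.
by exists (mxvec_index (mxvec_index a b) l') => X; rewrite mxvecE mxE mxvecE.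
Qed.

Lemma mx_coord_surj v : exists X : 'M[pow_quot (i pi) r]_N, mx_coord gr X = v.
Proof.
have [grV _ grVK] := gr_bij gr.
exists (vec_mx (\row_e grV (row e (vec_mx v)))); apply: (can_inj vec_mxK).
apply/row_matrixP => e; rewrite mxvecK rowK vec_mxK mxE grVK //.
Qed.

Lemma map_red_pow_quot_map :
  map_mx (@pow_quot_map o O i pi (i pi) r r) (map_mx (pow_red pi r) x) = map_mx red x.
Proof.
apply/matrixP => a b; rewrite !mxE /=; apply/pow_redP.
have /asboolP[c hc] : pow_rep (pow_red pi r (x a b)) - x a b \in pow_ideal pi r.
  by apply/pow_redP; rewrite pow_repK.
by apply/asboolP; exists (i c); rewrite -rmorphB hc rmorphM rmorphXn.
Qed.

Lemma rank_residue : (N * N <= \rank (map_mx rho L) + n)%N.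
Proof.
rewrite leqNgt; apply/negP => hlt.
have [half hh] := exists_half.
have hh' : red half *+ 2 = 1 by rewrite -rmorphMn hh rmorph1.
have JiJ : map_mx red (invmx J) *m map_mx red J = 1%:M.
  by rewrite -map_mxM mulVmx // map_mx1.
have JT' : (map_mx red J)^T = - map_mx red J \/ (map_mx red J)^T = map_mx red J.
  by rewrite map_trmx; case: JT => ->; [left; rewrite map_mxN|right].
have [y [hy hdy]] :=
  exists_small_centralizer JiJ hh' JT' mx_coord_entry entry_mx_coord.
have [pi0 piN dvr _] := hdvr.
(* The generic corank is at least n, so L(x) has a saturated kernel of rank n over [o], whose basis
   stays independent modulo pi. *)
have hrank : (\rank (map_mx (@tofrac o) L) + n <= N * N)%N.
  apply: leq_trans (rank_lie_centralizer_Kalg (z := map_mx j x) _).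
    rewrite leq_add2r -map_lie_centralizer_mx; apply: mxrank_map_le => a.
    by move=> /eqP; rewrite fmorph_eq0 => /eqP.
  by rewrite /cl_lie /= map_trmx -!map_mxM -map_mxD x_lie map_mx0.
have [U [E [UL UE]]] := saturated_kernel dvr hrank.
have Ufree : row_free (map_mx rho U).
  by apply/row_freeP; exists (map_mx rho E); rewrite -map_mxM UE map_mx1.
(* By the assumption for contradiction, the kernel modulo pi is larger than the reduction of the
   saturated one. *)
have [v0 v0L v0U] : exists2 v0 : 'rV[kalg]_(N * N),
    v0 *m map_mx rho L = 0 & row_free (col_mx (map_mx rho U) v0).
  have : ~~ (kermx (map_mx rho L) <= map_mx rho U)%MS.
    apply/negP => /mxrankS; rewrite mxrank_ker (eqP Ufree).
    by move: hlt; lia.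
  case/row_subPn => a ha; exists (row a (kermx (map_mx rho L))).
    by rewrite -row_mul mulmx_ker row0.
  set v0 := row _ _ in ha *.
  rewrite /row_free -addsmxE; apply/eqP.
  have hcap : (map_mx rho U :&: v0 = 0)%MS.
    apply/eqP; rewrite -mxrank_eq0; apply: contraNT ha => h0.
    apply: submx_trans (capmxSl (map_mx rho U) v0).
    rewrite -(geq_leqif (mxrank_leqif_sup (capmxSr _ _))) (leq_trans (rank_leq_row _)) //.
    by rewrite lt0n.
  have h0 : v0 != 0 by apply: contraNneq ha => ->; rewrite sub0mx.
  rewrite mxrank_disjoint_sum // (eqP Ufree) rank_rV h0 //.
have [v hv] := rv_mx_surj rv v0.
pose W := col_mx (map_mx red U) v.
have [|W' WW'] := @rv_right_inverse _ _ _ rv _ _ W.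
  by rewrite map_col_mx rres_red_mx hv.
(* The rows of [U] contribute free summands, of length r. The lift [v] is only known to satisfy v L
   = 0 modulo pi, so just its multiples by pi^(r - 1) are used, of length 1. *)
pose kappa l := if (l < n)%N then r else 1%N.
have hW (l : 'I_(n + 1)) : lie_centralizer (map_mx red J) (map_mx red x)
    (vec_mx (rv_unif rv ^+ (r - kappa l) *: row l W)).
  apply/lie_centralizer_mxP; rewrite -map_lie_centralizer_mx -scalemxAl -row_mul.
  rewrite mul_col_mx -map_mxM UL map_mx0 /kappa; case: (split_ordP l) => l' ->.
    by rewrite rowKu row0 scaler0.
  rewrite rowKd.
  apply/rowP => b; rewrite mxE mxE [RHS]mxE.
  have : rres ((v *m map_mx red L) l' b) = 0.
    have := congr1 (fun M : 'M_(1, _) => M l' b) v0L; rewrite [RHS]mxE -hv.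
    by rewrite -rres_red_mx -map_mxM mxE.
  case/(@rv_ker _ _ _ rv) => c ->; rewrite mulrA -exprSr.
  by rewrite subn1 prednK // rv_unif_nilpotent mul0r.
have hk l : (kappa l <= r)%N by rewrite /kappa; case: ifP.
have hge := centralizer_dim_ge JiJ hh' mx_coord_entry entry_mx_coord mx_coord_surj WW' hk hW.
(* Regularity transfers the bound [n * r] for [y] to [x], against the dimension r n + 1 just
   produced. *)
have [_ /(_ y hy)] := x_reg; rewrite map_red_pow_quot_map => /(_ _ hge) /hdy.
rewrite -(big_mkord xpredT kappa) addn1 big_nat_recr //= big_mkord.
rewrite (eq_bigr (fun=> r)) => [|l _]; last by rewrite /kappa ltn_ord.
by rewrite sum_nat_const card_ord /kappa ltnn -/n; lia.
Qed.

(** Both dimension bounds are applied with r = 1. The corank of L(x) over [Kalg] is at most that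
    over the residue field, hence at most n; any [z] in the Lie algebra has corank at least n, so
    its centralizer contains a chain of length n. *)
Lemma regular_over_Kalg : injective j ->
  cl_regular j J (@mxvec Kalg N N) (map_mx j x).
Proof.
move=> j_inj; split.
  by rewrite /cl_lie /= map_trmx -!map_mxM -map_mxD x_lie map_mx0.
have [half hh] := exists_half.
have hh' : j half *+ 2 = 1 by rewrite -rmorphMn hh rmorph1.
have JiJ : map_mx j (invmx J) *m map_mx j J = 1%:M.
  by rewrite -map_mxM mulVmx // map_mx1.
have phi_entry l : exists a b l', forall X : 'M[Kalg]_N,
    mxvec X 0 l = field_variety Kalg (X a b) 0 l'.
  case/mxvec_indexP: l => a b; exists a, b, 0 => X.
  by rewrite mxvecE; exact: esym (field_coordE _ _).
have entry_phi a b l' : exists l, forall X : 'M[Kalg]_N,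
    mxvec X 0 l = field_variety Kalg (X a b) 0 l'.
  by exists (mxvec_index a b) => X; rewrite mxvecE; exact: esym (field_coordE _ _).
have surj v : exists X : 'M[Kalg]_N, mxvec X = v by exists (vec_mx v); rewrite vec_mxK.
move=> z hz d hd.
have hdn : (d <= n)%N.
  have hr : (\rank (map_mx rho L) <= \rank (map_mx j L))%N.
    by apply: mxrank_map_le => a h; rewrite (j_inj a 0) ?rmorph0.
  have hB X : lie_centralizer (map_mx j J) (map_mx j x) X ->
      exists t, mxvec X = t *m row_base (kermx (map_mx j L)).
    move=> hX; apply/submxP; rewrite eq_row_base; apply/sub_kermxP.
    by rewrite map_lie_centralizer_mx; apply/lie_centralizer_mxP; rewrite mxvecK.
  have := centralizer_dim_le hh' phi_entry entry_phi hB hd.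
  by rewrite muln1 mxrank_ker; have := rank_residue; move: hr; lia.
apply: dim_geW hdn _.
have [U [Ufree UL]] := kermx_rows (rank_lie_centralizer_Kalg hz).
have [U' UU'] := row_freeP Ufree.
have hU (l : 'I_n) : lie_centralizer (map_mx j J) z
    (vec_mx (rv_unif (field_variety Kalg) ^+ (1 - 1) *: row l U)).
  rewrite subnn expr0 scale1r; apply/lie_centralizer_mxP.
  by rewrite -row_mul UL row0.
have := centralizer_dim_ge (kappa := fun=> 1%N) JiJ hh' phi_entry entry_phi surj UU'
  (fun=> isT) hU.
by rewrite sum_nat_const card_ord muln1.
Qed.
End Regularity.

Theorem proposition3p1p4
  (o : idomainType) (pi : o) (k : finFieldType) (res : {rmorphism o -> k})
  (Kalg : closedFieldType) (iota : {rmorphism {fraction o} -> Kalg})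
  (O : idomainType) (i : {rmorphism o -> O}) (j : {rmorphism O -> Kalg})
  (kalg : closedFieldType) (resO : {rmorphism O -> kalg})
  (N : nat) (J x : 'M[o]_N) (r : nat)
  (gr : greenberg_structure (i pi) resO r) :
  complete_dvr pi ->
  is_residue_map pi res -> (forall p, p \in [pchar k] -> odd p) ->
  is_algebraic_closure iota ->
  is_max_unramified_ring pi iota i j -> is_residue_map (i pi) resO ->
  J \in unitmx -> J^T = - J \/ J^T = J ->
  cl_lie idfun J x ->
  (1 <= r)%N -> cl_regular_mod gr J (map_mx (pow_red pi r) x) ->
  set_bij (cl_centralizer idfun J x) (centralizer_limit pi J x)
    (fun g m => map_mx (pow_red pi m.+1) g) /\
  cl_regular (iota \o @tofrac o) J (@mxvec Kalg N N)
    (map_mx (iota \o @tofrac o) x).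
Proof.
move=> hdvr hres odd_char _ [j_inj hji _] hresO uJ JT x_lie r_gt0 x_reg.
have Jid : map_mx idfun J = J by apply/matrixP => a b; rewrite mxE.
have iota_inj : injective (iota \o @tofrac o).
  by apply: inj_comp (fmorph_inj iota) _ => a b /eqP; rewrite tofrac_eq => /eqP.
have i_inj : injective i.
  by move=> a b /(congr1 j); rewrite !hji; apply: iota_inj.
split; first exact: centralizer_limit_bij.
rewrite /cl_lie /= Jid in x_lie.
exact: (regular_over_Kalg hdvr hres odd_char i_inj hresO uJ JT x_lie r_gt0 x_reg iota_inj).
Qed.
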